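(* Let $\Omega$ be either the closed annulus $A=\{z\in\mathbb{R}^2 : 1\le |z|\le 2\}$ or the open annulus $\mathring A=\{z\in\mathbb{R}^2 : 1<|z|<2\}$, and let $f:\Omega\to\Omega$ be an area preserving reversible map. Then either $f$ has no periodic points, or $f$ has infinitely many symmetric periodic points lying in the interior $\mathring A$.
   Context: Let $I:\mathbb{R}^2\to\mathbb{R}^2$, $I(x,y)=(-x,y)$. A connected planar domain $\Omega\subset\mathbb{R}^2$ is invariant if $I(\Omega)=\Omega$, and then $I_\Omega:=I|_\Omega$. Both $A$ and $\mathring A$ are invariant. A homeomorphism $f:\Omega\to\Omega$ of an invariant domain is called a reversible map if $f\circ I_\Omega=I_\Omega\circ f^{-1}$. It is area preserving if it preserves the standard (Lebesgue) area; no assumption on orientation is made. A point $z\in\Omega$ is a periodic point of $f$ if $f^k(z)=z$ for some $k\in\mathbb{N}=\{1,2,\dots\}$; it is a symmetric periodic point of $f$ if $f^k(z)=z$ and $f^\ell(z)=I_\Omega(z)$ for some $k,\ell\in\mathbb{N}$. *)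

(* Defs.v *)
From mathcomp Require Import all_boot all_order all_algebra.
From mathcomp Require Import all_classical all_reals all_analysis.
Set Implicit Arguments.
Unset Strict Implicit.
Unset Printing Implicit Defensive.
Import Order.TTheory GRing.Theory Num.Theory.
Import numFieldNormedType.Exports.
Local Open Scope classical_set_scope.
Local Open Scope ring_scope.

(* The library's norm [`|z|] on [R * R] is the max-norm, hence this one. *)
Definition euclid_norm (R : realType) (z : R * R) : R :=
  Num.sqrt (z.1 ^+ 2 + z.2 ^+ 2).

Definition closed_annulus (R : realType) : set (R * R) :=
  [set z | 1 <= euclid_norm z <= 2].

Definition open_annulus (R : realType) : set (R * R) :=
  [set z | 1 < euclid_norm z < 2].

Arguments closed_annulus : clear implicits.
Arguments open_annulus : clear implicits.

Definition reflection (R : realType) (z : R * R) : R * R := (- z.1, z.2).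

Definition area (R : realType) (B : set (R * R)) : \bar R :=
  (@lebesgue_measure R \x @lebesgue_measure R)%E B.

Definition borel_plane (R : realType) (B : set (R * R)) : Prop :=
  @measurable _ (measurableTypeR R * measurableTypeR R)%type B.

Definition invariant_domain (R : realType) (Omega : set (R * R)) : Prop :=
  @reflection R @` Omega = Omega.

(* A self-map of [Omega] is represented by a map of the whole plane, of which
   only the values on [Omega] matter; [pinv Omega f] is the library's inverse
   of the restriction of [f] to [Omega]. *)

Definition self_homeomorphism (R : realType) (Omega : set (R * R))
    (f : R * R -> R * R) : Prop :=
  [/\ set_bij Omega Omega f,
      {within Omega, continuous f} &
      {within Omega, continuous (pinv Omega f)}].

Definition reversible_map (R : realType) (Omega : set (R * R))
    (f : R * R -> R * R) : Prop :=
  [/\ invariant_domain Omega,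
      self_homeomorphism Omega f &
      forall z, Omega z -> f (reflection z) = reflection (pinv Omega f z)].

(* For a homeomorphism [f] of a Borel set [Omega], [f @` B] is again Borel, so
   [area (f @` B)] is its Lebesgue measure. *)
Definition area_preserving (R : realType) (Omega : set (R * R))
    (f : R * R -> R * R) : Prop :=
  forall B : set (R * R), borel_plane B -> B `<=` Omega ->
    area (f @` B) = area B.

Definition periodic_point (R : realType) (Omega : set (R * R))
    (f : R * R -> R * R) (z : R * R) : Prop :=
  Omega z /\ exists k : nat, (0 < k)%N /\ iter k f z = z.

Definition symmetric_periodic_point (R : realType) (Omega : set (R * R))
    (f : R * R -> R * R) (z : R * R) : Prop :=
  Omega z /\
  exists k l : nat, [/\ (0 < k)%N, (0 < l)%N,
    iter k f z = z & iter l f z = reflection z].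

Lemma reflectionK (R : realType) : involutive (@reflection R).
Proof. by case=> x y; rewrite /reflection /= opprK. Qed.

Lemma euclid_norm_reflection (R : realType) (z : R * R) :
  euclid_norm (reflection z) = euclid_norm z.
Proof. by rewrite /euclid_norm /= sqrrN. Qed.

Lemma closed_annulus_invariant (R : realType) :
  invariant_domain (closed_annulus R).
Proof.
apply/seteqP; split=> [_ [z Az <-]|z Az].
  by rewrite /closed_annulus /= euclid_norm_reflection.
exists (reflection z); last exact: reflectionK.
by rewrite /closed_annulus /= euclid_norm_reflection.
Qed.

Lemma open_annulus_invariant (R : realType) :
  invariant_domain (open_annulus R).
Proof.
apply/seteqP; split=> [_ [z Az <-]|z Az].
  by rewrite /open_annulus /= euclid_norm_reflection.
exists (reflection z); last exact: reflectionK.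
by rewrite /open_annulus /= euclid_norm_reflection.
Qed.

(* Main.v *)
(* Lift f to the universal cover of the open annulus, the (x, t)-plane, on which
   2 pi-translations in x act.  The square F of a lift commutes with them and
   satisfies F I = I F^-1; a point of the line L = {x = 0} sent by F^k to the line
   {x = n pi} then satisfies F^2k q = q + (2 pi n, 0), so it projects to a
   symmetric periodic point of "rotation number" n / 2k.  Normalise F to have a
   (near-)fixed point.
   If some F^k L reaches {|x| >= 4 pi}, the intermediate value theorem gives
   infinitely many rotation numbers.
   Otherwise all F^k L stay in {|x| < 4 pi}.  If only finitely many points of L are
   periodic, a power H of F fixes all of them, and H^k L meets L only there.  If
   there are none, the region between L and H L is wandering with bounded iterates,
   against area preservation.  If (0, c) is the highest one, lift H^2 to the
   universal cover of the plane minus (0, c): the arc {0} x ]c, +oo[ becomes a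
   properly embedded line disjoint from its images, and the same argument applies,
   the regions near x = +oo serving to choose a lift that does not rotate at
   infinity. *)

(* No Jordan curve theorem is involved. A line and its images are given as [K (0, r)] with an
   explicit inverse [K'], so a crossing is an intermediate value of the first coordinate of [K']
   along a segment, and sides of a curve are preimages of half-planes. Area enters only through
   [recurrent]. The annulus has finite area, so infinitely many images of an open set share a point;
   when the orbits upstairs are bounded, only finitely many deck translates of a lift of this point
   compete, and a true return in the cover follows. The threshold [4 pi] comes from the near-fixed
   point: one period [2 pi] to bring it next to the line, another for its displacement. Recurrence
   is known only in the first cover. In the cover of the punctured plane the wandering region is
   therefore kept in a strip on which the covering is injective, and recurrence is applied to its
   image. For the closed annulus the covering sees only the interior: the interior has to be shown
   invariant, which a winding number does, and the given periodic point may lie on the boundary,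
   whence a near-fixed point upstairs. *)
Require Import Defs.
From mathcomp Require Import all_boot all_order all_algebra.
From mathcomp Require Import all_classical all_reals all_analysis.
From mathcomp Require Import ring lra zify.
Import Order.TTheory GRing.Theory Num.Theory.
Import numFieldNormedType.Exports.
Local Open Scope classical_set_scope.
Local Open Scope ring_scope.
Set Implicit Arguments.
Unset Strict Implicit.
Unset Printing Implicit Defensive.

(** * Continuity and connectedness *)

Section cont.
Variables (R : realType) (T : topologicalType).
Implicit Types (f g : T -> R) (x : T).

Lemma contD f g x : continuous_at x f -> continuous_at x g ->
  continuous_at x (fun y => f y + g y).
Proof. by move=> cf cg; apply: continuousD. Qed.

Lemma contN f x : continuous_at x f -> continuous_at x (fun y => - f y).
Proof. by move=> cf; apply: continuousN. Qed.

Lemma contM f g x : continuous_at x f -> continuous_at x g ->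
  continuous_at x (fun y => f y * g y).
Proof. by move=> cf cg; apply: continuousM. Qed.

Lemma contX f n x : continuous_at x f ->
  continuous_at x (fun y => f y ^+ n).
Proof.
move=> cf; elim: n => [|n IHn]; first exact: cst_continuous.
have e : (fun y => f y * f y ^+ n) = (fun y => f y ^+ n.+1).
  by apply/funext => y; rewrite exprS.
exact: (eq_ind _ (fun h : T -> R => continuous_at x h) (contM cf IHn) _ e).
Qed.

Lemma contV f x : f x != 0 -> continuous_at x f ->
  continuous_at x (fun y => (f y)^-1).
Proof. by move=> f0 cf; apply: cvgV. Qed.

Lemma contC (U : topologicalType) (c : U) x : continuous_at x (fun _ : T => c).
Proof. exact: cst_continuous. Qed.

Lemma contI x : continuous_at x (fun y : T => y).
Proof. by []. Qed.

Lemma contF (U V : topologicalType) (h : U -> V) (k : T -> U) x :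
  continuous_at (k x) h -> continuous_at x k -> continuous_at x (fun y => h (k y)).
Proof. by move=> ch ck; apply: (@continuous_comp _ _ _ k h). Qed.

Lemma cont_pair (U V : topologicalType) (f : T -> U) (g : T -> V) x :
  continuous_at x f -> continuous_at x g ->
  continuous_at x (fun y => (f y, g y)).
Proof. by move=> cf cg; apply: cvg_pair. Qed.

Lemma cont1 (U V : topologicalType) (f : T -> U * V) x :
  continuous_at x f -> continuous_at x (fun y => (f y).1).
Proof. by move=> cf; apply: (contF (h := fst)) => //; apply: cvg_fst. Qed.

Lemma cont2 (U V : topologicalType) (f : T -> U * V) x :
  continuous_at x f -> continuous_at x (fun y => (f y).2).
Proof. by move=> cf; apply: (contF (h := snd)) => //; apply: cvg_snd. Qed.

Lemma cont_sin f x : continuous_at x f -> continuous_at x (fun y => sin (f y)).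
Proof. by move=> cf; apply: contF => //; apply: continuous_sin. Qed.

Lemma cont_cos f x : continuous_at x f -> continuous_at x (fun y => cos (f y)).
Proof. by move=> cf; apply: contF => //; apply: continuous_cos. Qed.

Lemma cont_atan f x : continuous_at x f -> continuous_at x (fun y => atan (f y)).
Proof. by move=> cf; apply: contF => //; apply: continuous_atan. Qed.

Lemma cont_sqrt f x : continuous_at x f -> continuous_at x (fun y => Num.sqrt (f y)).
Proof. by move=> cf; apply: contF => //; apply: sqrt_continuous. Qed.

Lemma cont_norm f x : continuous_at x f -> continuous_at x (fun y => `|f y|).
Proof. by move=> cf; apply: contF => //; apply: norm_continuous. Qed.

Lemma cont_gt f x (c : R) : continuous_at x f -> c < f x ->
  \forall y \near x, c < f y.
Proof. by move=> cf; apply: (cvgr_gt _ cf). Qed.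

Lemma cont_lt f x (c : R) : continuous_at x f -> f x < c ->
  \forall y \near x, f y < c.
Proof. by move=> cf; apply: (cvgr_lt _ cf). Qed.

Lemma open_gt_preimage f (c : R) : continuous f -> open [set x | c < f x].
Proof.
move=> cf; apply: (@open_comp _ _ f [set y | c < y]) => [x _|]; first exact: cf.
exact: open_gt.
Qed.

Lemma open_lt_preimage f (c : R) : continuous f -> open [set x | f x < c].
Proof.
move=> cf; apply: (@open_comp _ _ f [set y | y < c]) => [x _|]; first exact: cf.
exact: open_lt.
Qed.

End cont.

Ltac cont_step := match goal with
  | H : continuous_at ?x ?f |- continuous_at ?x ?f => exact: H
  | H : continuous ?f |- continuous_at ?x ?f => exact: H
  | |- continuous_at ?x (fun _ => ?c) => exact: contC
  | |- continuous_at ?x (fun y => y) => exact: contI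
  | |- continuous_at ?x (fun y => (@?f y, @?g y)) => apply: (@cont_pair _ _ _ f g x)
  | |- continuous_at ?x (fun y => @?f y + @?g y) => apply: (@contD _ _ f g x)
  | |- continuous_at ?x (fun y => - @?f y) => apply: (@contN _ _ f x)
  | |- continuous_at ?x (fun y => @?f y * @?g y) => apply: (@contM _ _ f g x)
  | |- continuous_at ?x (fun y => @?f y ^+ ?n) => apply: (@contX _ _ f n x)
  | |- continuous_at ?x (fun y => sin (@?f y)) => apply: (@cont_sin _ _ f x)
  | |- continuous_at ?x (fun y => cos (@?f y)) => apply: (@cont_cos _ _ f x)
  | |- continuous_at ?x (fun y => atan (@?f y)) => apply: (@cont_atan _ _ f x)
  | |- continuous_at ?x (fun y => Num.sqrt (@?f y)) => apply: (@cont_sqrt _ _ f x)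
  | |- continuous_at ?x (fun y => `|@?f y|) => apply: (@cont_norm _ _ f x)
  | |- continuous_at ?x (fun y => (@?f y).1) => apply: (@cont1 _ _ _ f x)
  | |- continuous_at ?x (fun y => (@?f y).2) => apply: (@cont2 _ _ _ f x)
  | H : continuous ?h |- continuous_at ?x (fun y => ?h (@?f y)) =>
      apply: (@contF _ _ _ h f x); first exact: H
  end.

Ltac cont := repeat (cont_step; cbv beta).

Section prelim.
Variable R : realType.
Implicit Types (z w : R * R) (a b t : R).

Definition seg z w t : R * R := (z.1 + t * (w.1 - z.1), z.2 + t * (w.2 - z.2)).

Lemma seg0 z w : seg z w 0 = z.
Proof. by rewrite /seg !mul0r !addr0; case: z. Qed.

Lemma seg1 z w : seg z w 1 = w.
Proof. by rewrite /seg !mul1r !subrKC; case: w. Qed.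

Lemma continuous_seg z w : continuous (seg z w).
Proof. by move=> t; rewrite /seg; cont. Qed.

Lemma ivt_le (f : R -> R) a b c : a <= b -> continuous f ->
  f a <= c <= f b \/ f b <= c <= f a -> exists2 t, a <= t <= b & f t = c.
Proof.
move=> ab cf fc.
have [t] : exists2 t, t \in `[a, b]%R & f t = c.
  apply: IVT => //; first exact: continuous_subspaceT.
  by case: fc => /andP[f1 f2]; rewrite ge_min le_max f1 f2 ?orbT.
by rewrite in_itv /= => abt ftc; exists t.
Qed.

Lemma ivt_seg (h : R * R -> R) z w c : continuous h ->
  h z <= c <= h w \/ h w <= c <= h z ->
  exists2 t, 0 <= t <= 1 & h (seg z w t) = c.
Proof.
move=> ch hc.
apply: (@ivt_le (h \o seg z w)); rewrite ?ler01 //=; last by rewrite seg0 seg1.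
by move=> t; apply: continuous_comp; [exact: continuous_seg|exact: ch].
Qed.

Lemma seg_gt z w t c : 0 <= t <= 1 -> c < z.1 -> c < w.1 -> c < (seg z w t).1.
Proof.
move=> /andP[t0 t1] zc wc /=.
by have [h|h] := leP t (1 / 2); nra.
Qed.

Lemma seg_lt z w t c : 0 <= t <= 1 -> z.1 < c -> w.1 < c -> (seg z w t).1 < c.
Proof.
move=> /andP[t0 t1] zc wc /=.
by have [h|h] := leP t (1 / 2); nra.
Qed.

Lemma seg_ge z w t c : 0 <= t <= 1 -> c <= z.1 -> c <= w.1 -> c <= (seg z w t).1.
Proof. by move=> /andP[t0 t1] zc wc /=; nra. Qed.

Lemma seg_le z w t c : 0 <= t <= 1 -> z.1 <= c -> w.1 <= c -> (seg z w t).1 <= c.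
Proof. by move=> /andP[t0 t1] zc wc /=; nra. Qed.

Lemma floor_unit (u x : R) : 0 < u ->
  exists n : int, u * n%:~R <= x < u * (n%:~R + 1).
Proof.
move=> u0; exists (Num.floor (x / u)).
have /andP[h1 h2] := floor_itv (x / u).
rewrite mulrC -ler_pdivlMr // h1 /= mulrC -ltr_pdivrMr //.
by move: h2; rewrite intrD.
Qed.

Lemma sin_cos_2pin x (n : int) :
  sin (x + 2 * pi * n%:~R) = sin x :> R /\ cos (x + 2 * pi * n%:~R) = cos x :> R.
Proof.
have e : 2 * pi = pi *+ 2 :> R by rewrite mulr_natl.
have P m : sin (x + 2 * pi * m%:R) = sin x :> R /\ cos (x + 2 * pi * m%:R) = cos x :> R.
  rewrite e mulr_natr.
  by rewrite (periodicn (@sinD2pi R)) (periodicn (@cosD2pi R)).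
case: n => m; first exact: P.
have /= := P m.+1; rewrite NegzE mulrNz mulrN.
(* Rotation by [u] fixes the unit vector of angle [x], which forces [cos u = 1] and [sin u = 0]; the
   rotation by [- u] is then trivial too. *)
move: (2 * pi * m.+1%:R) => u [hs hc].
rewrite sinB cosB; rewrite sinD in hs; rewrite cosD in hc.
have := cos2Dsin2 x; move: hs hc; move: (sin x) (cos x) (sin u) (cos u) => s c s' c' hs hc e1.
have c'1 : c' = 1.
  have : (s * c' + c * s') * s + (c * c' - s * s') * c = s * s + c * c by rewrite hs hc.
  have -> : (s * c' + c * s') * s + (c * c' - s * s') * c = (c^+2 + s^+2) * c' by ring.
  by rewrite e1 mul1r => ->; rewrite -e1; ring.
have s'0 : s' = 0.
  have : (s * c' + c * s') * c - (c * c' - s * s') * s = s * c - c * s by rewrite hs hc.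
  have -> : (s * c' + c * s') * c - (c * c' - s * s') * s = (c^+2 + s^+2) * s' by ring.
  by rewrite e1 mul1r => ->; ring.
by rewrite c'1 s'0; split; ring.
Qed.

Lemma cos_eq1_0 x : 0 <= x < 2 * pi -> cos x = 1 :> R -> x = 0.
Proof.
move=> /andP[x0 x2] cx.
have [xp|xp] := leP x pi.
  apply: (@cos_inj R); rewrite ?cos0 // in_itv /=; first by apply/andP.
  by rewrite lexx pi_ge0.
have : cos (x - pi) = -1.
  by rewrite cosB cospi sinpi cx mulr0 addr0 mulrN1.
rewrite -cospi => /(@cos_inj R).
have := pi_gt0 R; move=> p0; rewrite !in_itv /= => h.
have : x - pi = pi by apply: h; lra.
lra.
Qed.

Lemma sin_cos_inj a b : sin a = sin b -> cos a = cos b ->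
  exists n : int, b = a + 2 * pi * n%:~R.
Proof.
move=> hs hc.
have p0 := pi_gt0 R.
have [n /andP[n1 n2]] := @floor_unit (2 * pi) (b - a) ltac:(by rewrite mulr_gt0).
exists n; apply/eqP; rewrite -subr_eq0 opprD addrA; apply/eqP.
apply: cos_eq1_0; first by apply/andP; split; lra.
rewrite -mulrN -intrN; have [_ ->] := sin_cos_2pin (b - a) (- n).
by rewrite cosB hs hc -!expr2 cos2Dsin2.
Qed.

Lemma continuous_const (h : R * R -> R) a : continuous h ->
  (forall z, exists n : int, h z = a + 2 * pi * n%:~R) ->
  exists n : int, forall z, h z = a + 2 * pi * n%:~R.
Proof.
move=> ch hn; have [n hn0] := hn (0, 0); exists n => z; rewrite -hn0.
wlog lt : h a n ch hn hn0 / h z < h (0, 0) => [W|].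
  have [lt|gt|//] := ltgtP (h z) (h (0, 0)); first exact: (W h a n).
  have W' : - h z = - h (0, 0).
    apply: (W (fun z => - h z) (- a) (- n)); rewrite ?ltrN2 //.
    - by move=> x; apply: contN; exact: ch.
    - by move=> x; have [m ->] := hn x; exists (- m); rewrite intrN; ring.
    - by rewrite hn0 intrN; ring.
  by apply: oppr_inj.
exfalso.
have p0 := pi_gt0 R.
have [m hm] := hn z.
have lemn : m%:~R + 1 <= n%:~R :> R.
  have : m%:~R < n%:~R :> R by move: lt; rewrite hm hn0; nra.
  by rewrite ltr_int -(intrD _ m 1) ler_int lezD1.
have [t _ ht] := @ivt_seg h z (0, 0) (h z + pi) ch ltac:(left; rewrite hm hn0; nra).
have [k hk] := hn (seg z (0, 0) t).
have e : 2 * (k%:~R - m%:~R) = 1 :> R.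
  have : pi * (2 * (k%:~R - m%:~R) - 1) = 0 :> R by move: ht; rewrite hk hm; lra.
  by move/eqP; rewrite mulf_eq0 gt_eqF //= subr_eq0 => /eqP.
have {e} : (2 * (k - m))%:~R = 1%:~R :> R by rewrite intrM intrB.
by move/eqP; rewrite eqr_int; lia.
Qed.

Lemma continuous_avoid (h : R * R -> R) c : continuous h ->
  (forall z, h z != c) -> (forall z, h z < c) \/ (forall z, c < h z).
Proof.
move=> ch hc; have [lt|gt|e] := ltgtP (h (0, 0)) c; last 1 first.
- by have := hc (0, 0); rewrite e eqxx.
- left=> z; rewrite ltNge; apply/negP => cz.
  have [t _ ht] := @ivt_seg h (0,0) z c ch ltac:(left; rewrite cz ltW //).
  by have := hc (seg (0,0) z t); rewrite ht eqxx.
- right=> z; rewrite ltNge; apply/negP => cz.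
  have [t _ ht] := @ivt_seg h (0,0) z c ch ltac:(right; rewrite cz ltW //).
  by have := hc (seg (0,0) z t); rewrite ht eqxx.
Qed.

Lemma int_eq0 (n : int) : -1 < n%:~R :> R -> n%:~R < 1 :> R -> n = 0.
Proof.
move=> h1 h2.
have l1 : (-1)%:~R < n%:~R :> R by rewrite intrN.
have l2 : n%:~R < 1%:~R :> R by [].
rewrite ltr_int in l1; rewrite ltr_int in l2.
by clear -l1 l2; lia.
Qed.

Lemma odd_turn_far a (k m : int) : ~ `|a + pi + 2 * pi * k%:~R + 2 * pi * m%:~R - a| < pi / 2.
Proof.
have p0 := pi_gt0 R; rewrite ltr_norml => /andP[h1 h2].
have e : (k + m)%:~R = k%:~R + m%:~R :> R by rewrite intrD.
have l1 : (k + m)%:~R < 0 :> R by rewrite e; nra.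
have l2 : -1 < (k + m)%:~R :> R by rewrite e; nra.
have km : k + m = 0 by apply: int_eq0 l2 (lt_trans l1 ltr01).
by move: l1; rewrite km ltxx.
Qed.

End prelim.

(** * Lifting angles and coverings *)

Section angle.
Variable R : realType.
Implicit Types (z w y : R * R) (a b t : R).
Local Notation N := (@euclid_norm R).

Lemma euclid_norm_sqr y : N y ^+ 2 = y.1 ^+ 2 + y.2 ^+ 2.
Proof. by rewrite sqr_sqrtr // addr_ge0 ?sqr_ge0. Qed.

Lemma euclid_norm_ge0 y : 0 <= N y.
Proof. exact: sqrtr_ge0. Qed.

Lemma euclid_norm_eq0 y : N y = 0 -> y = (0, 0).
Proof.
move=> n0; have := euclid_norm_sqr y; rewrite n0 expr0n /= => /esym/eqP.
rewrite paddr_eq0 ?sqr_ge0 // !sqrf_eq0 => /andP[/eqP h1 /eqP h2].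
by case: y h1 h2 {n0} => /= ? ? -> ->.
Qed.

Lemma euclid_norm_polar a t : 0 <= t -> N (t * sin a, t * cos a) = t.
Proof.
move=> t0; rewrite /euclid_norm /= !exprMn -mulrDr addrC cos2Dsin2 mulr1.
by rewrite sqrtr_sqr ger0_norm.
Qed.

Lemma cont_enorm (T : topologicalType) (f : T -> R * R) (x : T) :
  continuous_at x f -> continuous_at x (fun u => N (f u)).
Proof. by move=> cf; rewrite /euclid_norm; cont. Qed.

Definition has_angle y a := y = (N y * sin a, N y * cos a).

Definition dirdot a y := y.1 * sin a + y.2 * cos a.

(* Angles are measured from the positive second axis, as [reflection] then acts by
   [a |-> - a].  When [0 < dirdot a y], this is the angle of [y] closest to [a];
   otherwise it is junk. *)
Definition angle_near a y :=
  a + atan ((y.1 * cos a - y.2 * sin a) / dirdot a y).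

Lemma has_angle_near a y : 0 < dirdot a y -> has_angle y (angle_near a y).
Proof.
rewrite /has_angle /angle_near; set d := dirdot a y => d0.
set c := y.1 * cos a - y.2 * sin a.
have sc := cos2Dsin2 a.
have nE : N y ^+ 2 = d ^+ 2 + c ^+ 2.
  rewrite euclid_norm_sqr /d /c /dirdot; transitivity ((y.1^+2 + y.2^+2) * (cos a ^+ 2 + sin a ^+ 2)); last by ring.
  by rewrite sc mulr1.
have n0 : 0 < N y.
  rewrite lt_neqAle euclid_norm_ge0 andbT eq_sym; apply/eqP => n0.
  by move: nE (exprn_gt0 2 d0) (sqr_ge0 c); rewrite n0; lra.
have ca : cos (atan (c / d)) = d / N y.
  rewrite cos_atan.
  have -> : 1 + (c / d) ^+ 2 = (N y / d) ^+ 2.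
    by rewrite !expr_div_n nE; field; rewrite gt_eqF.
  by rewrite sqrtr_sqr ger0_norm ?divr_ge0 ?ltW // invf_div.
have sa : sin (atan (c / d)) = c / N y.
  have <- : tan (atan (c / d)) * cos (atan (c / d)) = sin (atan (c / d)).
    by rewrite /tan divfK // ca gt_eqF // divr_gt0.
  by rewrite atanK ca; field; rewrite !gt_eqF.
rewrite sinD cosD sa ca [LHS]surjective_pairing; congr pair.
- transitivity (y.1 * (cos a ^+ 2 + sin a ^+ 2)); first by rewrite sc mulr1.
  by rewrite /d /c /dirdot; field; rewrite gt_eqF.
- transitivity (y.2 * (cos a ^+ 2 + sin a ^+ 2)); first by rewrite sc mulr1.
  by rewrite /d /c /dirdot; field; rewrite gt_eqF.
Qed.

Lemma angle_near_bound a y : a - pi / 2 < angle_near a y < a + pi / 2.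
Proof.
rewrite /angle_near; have := atan_gtNpi2 ((y.1 * cos a - y.2 * sin a) / dirdot a y).
have := atan_ltpi2 ((y.1 * cos a - y.2 * sin a) / dirdot a y); move: (atan _) => u.
by move=> ? ?; apply/andP; split; lra.
Qed.

Lemma cont_angle_near (T : topologicalType) (f : T -> R) (g : T -> R * R) (x : T) :
  0 < dirdot (f x) (g x) -> continuous_at x f -> continuous_at x g ->
  continuous_at x (fun u => angle_near (f u) (g u)).
Proof.
move=> d0 cf cg; rewrite /angle_near /dirdot; cont.
by apply: contV; [rewrite gt_eqF | cont].
Qed.

Lemma has_angle_inj y a b : y != (0, 0) -> has_angle y a -> has_angle y b ->
  exists n : int, b = a + 2 * pi * n%:~R.
Proof.
move=> y0 ha hb.
have n0 : N y != 0 by apply: contra y0 => /eqP/euclid_norm_eq0 ->.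
have [] : (N y * sin a, N y * cos a) = (N y * sin b, N y * cos b) by rewrite -ha -hb.
by move=> /(mulfI n0) hs /(mulfI n0) hc; exact: sin_cos_inj.
Qed.

Definition angle_lift (h : R * R -> R * R) (A : R * R -> R) :=
  continuous A /\ forall z, has_angle (h z) (A z).

Definition dot z w := z.1 * w.1 + z.2 * w.2.

(** The scalar product is [N (h0 z)] times [dirdot (A z) (h1 z)], so its positivity puts [h1 z] in
    the half-plane where [angle_near (A z)] is a true and continuous angle. *)
Lemma angle_lift_step h0 h1 A : angle_lift h0 A -> continuous h1 ->
  (forall z, 0 < dot (h0 z) (h1 z)) ->
  angle_lift h1 (fun z => angle_near (A z) (h1 z)).
Proof.
move=> [cA hA] ch1 d.
have d0 z : 0 < dirdot (A z) (h1 z).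
  have : dot (h0 z) (h1 z) = N (h0 z) * dirdot (A z) (h1 z).
    rewrite {1}[h0 z]hA /dot /dirdot /=; ring.
  move=> e; have := d z; rewrite e pmulr_rgt0 //.
  rewrite lt_neqAle euclid_norm_ge0 andbT eq_sym; apply/eqP => n0.
  by have := d z; rewrite e n0 mul0r ltxx.
by split=> z; [apply: cont_angle_near | exact: has_angle_near].
Qed.

Lemma has_angle_ex y : exists a, has_angle y a.
Proof.
have [->|y0] := eqVneq y (0, 0).
  by exists 0; rewrite /has_angle /euclid_norm /= expr0n /= addr0 sqrtr0 !mul0r.
have P w : 0 < w.2 -> exists a, has_angle w a.
  move=> w2; exists (angle_near 0 w); apply: has_angle_near.
  by rewrite /dirdot sin0 cos0; lra.
have Q w : 0 < w.1 -> exists a, has_angle w a.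
  move=> w2; exists (angle_near (pi / 2) w); apply: has_angle_near.
  by rewrite /dirdot sin_pihalf cos_pihalf; lra.
have S w : (exists a, has_angle (- w.1, - w.2) a) -> exists a, has_angle w a.
  case=> a; rewrite /has_angle /euclid_norm /= !sqrrN => -[h1 h2]; exists (a + pi).
  by rewrite sinDpi cosDpi !mulrN -h1 -h2 !opprK; case: w {h1 h2}.
have [lt|gt|e] := ltgtP y.2 0.
- by apply: S; apply: P => /=; lra.
- exact: P.
have [lt|gt|e'] := ltgtP y.1 0.
- by apply: S; apply: Q => /=; lra.
- exact: Q.
by case: y e e' y0 {P Q S} => /= ? ? -> ->; rewrite eqxx.
Qed.

(** Truncation to [[- M, M]] for nonnegative [M], written with absolute values so that continuity is
    immediate. *)
Definition clamp M t : R := (`|t + M| - `|t - M|) / 2.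

Lemma clamp_id M t : `|t| <= M -> clamp M t = t.
Proof.
rewrite ler_norml /clamp => /andP[h1 h2].
by rewrite ger0_norm ?ler0_norm; lra.
Qed.

Lemma clamp_le M t : 0 <= M -> `|clamp M t| <= M.
Proof.
move=> M0; rewrite /clamp ler_norml.
have [h1|h1] := ger0P (t + M); have [h2|h2] := ger0P (t - M);
  by apply/andP; split; lra.
Qed.

End angle.

Section lift.
Variable R : realType.
Implicit Types (z w y : R * R) (a b t : R).
Local Notation N := (@euclid_norm R).

Definition square (M : R) : set (R * R) := [set z | `|z.1| <= M /\ `|z.2| <= M].

(** At step size 0 the scalar product is the squared norm of [h], hence positive; compactness of the
    product of [[0, 1]] and the square makes one positive step size serve everywhere. *)
Lemma dot_uniform (h : R * R -> R * R) (M : R) : continuous h ->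
  (forall z, h z != (0, 0)) ->
  exists n : nat, forall (s : R) z, 0 <= s <= 1 -> square M z ->
   0 < dot (h (s * z.1, s * z.2)) (h ((s + n.+1%:R^-1) * z.1, (s + n.+1%:R^-1) * z.2)).
Proof.
move=> ch h0.
pose A : set (R * (R * R)) := `[0, 1] `*` (`[- M, M] `*` `[- M, M]).
have cA : compact A by do !apply: compact_setX; exact: segment_compact.
pose F (p : R * (R * R) * R) : R :=
  dot (h (p.1.1 * p.1.2.1, p.1.1 * p.1.2.2))
      (h ((p.1.1 + p.2) * p.1.2.1, (p.1.1 + p.2) * p.1.2.2)).
have cF : continuous F.
  move=> p; rewrite /F /dot; cont.
have H : \forall d \near (0 : R), forall p, A p -> 0 < F (p, d).
  have Q := (proj1 (compact_near_coveringP A)) cA R (nbhs (0 : R))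
    (fun d p => 0 < F (p, d)) (nbhs_filter _).
  apply: Q => p Ap; apply: (cont_gt (x := (p, 0)) (cF _)).
  rewrite /F /= !addr0 /dot -!expr2 -euclid_norm_sqr exprn_gt0 //.
  rewrite lt_neqAle euclid_norm_ge0 andbT eq_sym.
  by apply: contra_neqN (h0 (p.1 * p.2.1, p.1 * p.2.2)) => /eqP/euclid_norm_eq0.
have [e /= e0 He] := H.
have [k] := ltr_add_invr (y := 0) (x := e) e0; rewrite add0r => ke.
exists k => s z s01 [z1 z2].
apply: (He k.+1%:R^-1 _ (s, z)).
  by rewrite /= sub0r normrN ger0_norm ?invr_ge0.
by split; [|split]; rewrite /= in_itv //= -ler_norml.
Qed.

Definition scale (s : R) z := (s * z.1, s * z.2).

Definition clamp2 (M : R) z := (clamp M z.1, clamp M z.2).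

Lemma continuous_clamp2 M : continuous (clamp2 M).
Proof. by move=> z; rewrite /clamp2 /clamp; cont. Qed.

Lemma square_clamp2 M z : 0 <= M -> square M (clamp2 M z).
Proof. by move=> M0; split; exact: clamp_le. Qed.

Lemma clamp2_id M z : square M z -> clamp2 M z = z.
Proof. by move=> [z1 z2]; rewrite /clamp2 !clamp_id //; case: z {z1 z2}. Qed.

(* The homotopy [s |-> h (s z)] from a constant is lifted in steps so small that
   consecutive values have a positive scalar product. *)
Lemma angle_lift_clamp (h : R * R -> R * R) (M : R) : 0 <= M -> continuous h ->
  (forall z, h z != (0, 0)) ->
  exists A, angle_lift (h \o clamp2 M) A.
Proof.
move=> M0 ch h0; have [n hn] := dot_uniform M ch h0.
have cc := @continuous_clamp2 M.
suff L i : (i <= n.+1)%N ->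
    exists A, angle_lift (h \o scale (i%:R / n.+1%:R) \o clamp2 M) A.
  have [A [cA hA]] := L n.+1 (leqnn _); exists A; split=> // z.
  by have := hA z; rewrite /= divff ?pnatr_eq0 // /scale !mul1r; case: clamp2.
elim: i => [_|i IHi lin].
  have [a ha] := has_angle_ex (h (0, 0)); exists (fun=> a).
  split=> z /=; first exact: contC.
  by rewrite /scale !mul0r.
have [A hA] := IHi (ltnW lin).
eexists; apply: (angle_lift_step hA).
  by move=> z; rewrite /comp /scale; cont.
move=> z; pose s : R := i%:R / n.+1%:R.
have s01 : 0 <= s <= 1.
  apply/andP; split; first exact: divr_ge0. by rewrite ler_pdivrMr ?ltr0n // mul1r ler_nat ltnW.
have := hn _ _ s01 (square_clamp2 z M0).
by rewrite /= /scale /s -[i.+1%:R]natr1 [(_ + 1) / _]mulrDl mul1r.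
Qed.

Lemma has_angle_deck y a (n : int) : has_angle y a ->
  has_angle y (a + 2 * pi * n%:~R).
Proof. by rewrite /has_angle; have [-> ->] := sin_cos_2pin a n. Qed.

Lemma angle_lift_unique h A B : (forall z, h z != (0, 0)) ->
  angle_lift h A -> angle_lift h B ->
  exists n : int, forall z, B z = A z + 2 * pi * n%:~R.
Proof.
move=> h0 [cA hA] [cB hB].
have [] := @continuous_const R (fun z => B z - A z) 0.
- by move=> z; cont.
- by move=> z; have [n ->] := has_angle_inj (h0 z) (hA z) (hB z); exists n; ring.
- by move=> n hn; exists n => z; rewrite -[B z](subrK (A z)) hn; ring.
Qed.

(** The lifts over the squares of integer size are normalised to the same angle [a0] at the origin;
    by uniqueness they agree on smaller squares and glue. *)
Lemma angle_lift_exists (h : R * R -> R * R) : continuous h ->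
  (forall z, h z != (0, 0)) -> exists A, angle_lift h A.
Proof.
move=> ch h0; have [a0 ha0] := has_angle_ex (h (0, 0)).
have c0 M : 0 <= M -> clamp2 M (0, 0) = (0, 0) :> R * R.
  by move=> M0; rewrite clamp2_id //; split; rewrite /= normr0.
have ex (n : nat) : exists A, angle_lift (h \o clamp2 n%:R) A /\ A (0, 0) = a0.
  have [A [cA hA]] := angle_lift_clamp (ler0n _ n) ch h0.
  have hA0 := hA (0, 0); rewrite /= c0 // in hA0.
  have [m hm] := has_angle_inj (h0 _) hA0 ha0.
  exists (fun z => A z + 2 * pi * m%:~R); split=> //; split=> z; first by cont.
  exact: has_angle_deck.
have [A hA] := choice ex.
have eqA m n z : (m <= n)%N -> square m%:R z -> A m z = A n z.
  move=> mn sz.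
  have cc := @continuous_clamp2 m%:R.
  have [[cm hm] m0] := hA m; have [[cn hn] n0] := hA n.
  have Lm : angle_lift (h \o clamp2 m%:R) (A m \o clamp2 m%:R).
    split=> y; first by rewrite /comp; cont.
    have := hm (clamp2 m%:R y); rewrite /= (clamp2_id (square_clamp2 y _)) //.
  have Ln : angle_lift (h \o clamp2 m%:R) (A n \o clamp2 m%:R).
    split=> y; first by rewrite /comp; cont.
    have := hn (clamp2 m%:R y); rewrite /= (@clamp2_id n%:R) //.
    have [y1 y2] := square_clamp2 y (ler0n R m).
    by split; [apply: le_trans y1 _|apply: le_trans y2 _]; rewrite ler_nat.
  have [k hk] := angle_lift_unique (fun y => h0 _) Lm Ln.
  have := hk (0, 0); rewrite /= c0 // m0 n0 => k0.
  by have := hk z; rewrite /= clamp2_id // => ->; lra.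
pose sz z : R := `|z.1| + `|z.2|.
have csz : continuous sz by move=> z; rewrite /sz; cont.
pose r z := Num.bound (sz z).
have szr z (n : nat) : sz z < n%:R -> square n%:R z.
  move=> h1; have n1 := normr_ge0 z.1; have n2 := normr_ge0 z.2.
  by split; rewrite /sz in h1; lra.
have rP z : square (r z)%:R z.
  by apply: szr; apply: archi_boundP; rewrite addr_ge0.
have AE n z : square n%:R z -> A (r z) z = A n z.
  move=> hz; have [h1|h1] := leqP n (r z); first by rewrite (eqA _ _ _ h1).
  by rewrite (eqA _ _ _ (ltnW h1)).
exists (fun z => A (r z) z); split=> z; last first.
  by have [[_ /(_ z)]] := hA (r z); rewrite /= clamp2_id.
pose n := Num.bound (sz z + 1).
have zn : sz z < n%:R.
  apply: lt_trans (archi_boundP _); first by rewrite ltrDl.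
  by rewrite !addr_ge0.
have [[cn _] _] := hA n.
rewrite /continuous_at (AE n); last exact: szr.
have H : \forall y \near z, sz y < n%:R by exact: (cont_lt (csz z) zn).
apply: cvg_trans (cn z); apply: near_eq_cvg.
by apply: filterS H => y hy; rewrite (AE n) //; apply: szr.
Qed.

Definition deck (n : int) z : R * R := (z.1 + 2 * pi * n%:~R, z.2).

Lemma deck0 z : deck 0 z = z.
Proof. by rewrite /deck mulr0 addr0; case: z. Qed.

Lemma deckD m n z : deck m (deck n z) = deck (m + n) z.
Proof. by rewrite /deck /= intrD; congr pair; ring. Qed.

Lemma continuous_deck n : continuous (deck n).
Proof. by move=> z; rewrite /deck; cont. Qed.

Lemma reflection_deck n z : reflection (deck n z) = deck (- n) (reflection z).
Proof. by rewrite /deck /reflection /= intrN; congr pair; ring. Qed.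

Lemma deck_inj n z w : deck n z = deck n w -> z = w.
Proof. by move=> /(congr1 (deck (- n))); rewrite !deckD addNr !deck0. Qed.

Lemma deck_eq m n z : deck m z = deck n z -> m = n.
Proof.
move=> /(congr1 fst) /= /addrI /mulfI -/(_ _)/intr_inj; apply.
by rewrite mulf_neq0 // gt_eqF // pi_gt0.
Qed.

Lemma continuous_reflection : continuous (@reflection R).
Proof. by move=> z; rewrite /reflection; cont. Qed.

(* A universal covering of its range, compatible with the reflections. *)
Definition covering (E : R * R -> R * R) := [/\ continuous E,
  forall z w, E z = E w <-> exists n, w = deck n z,
  forall z, E (reflection z) = reflection (E z) &
  forall g, continuous g -> (forall z, exists w, E w = g z) ->
    exists G, continuous G /\ forall z, E (G z) = g z].

Definition polar (c : R) (phi : R -> R) z : R * R :=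
  (phi z.2 * sin z.1, c + phi z.2 * cos z.1).

(** A map into the range lifts by an angle lift around [(0, c)] in the first coordinate and by [psi]
    of the distance to [(0, c)] in the second. Continuity of [psi] is asked on the range of [phi],
    as for [ln] and [ann_height]. *)
Lemma polar_covering (c : R) (phi psi : R -> R) : continuous phi -> (forall t, 0 < phi t) ->
  cancel phi psi -> (forall t, continuous_at (phi t) psi) ->
  covering (polar c phi).
Proof.
move=> cphi phi0 phiK cpsi; split.
- by move=> z; rewrite /polar; cont.
- move=> z w; split=> [|[n ->]]; last first.
    by rewrite /polar /=; have [-> ->] := sin_cos_2pin z.1 n.
  case=> h1 /addrI h2.
  have e : phi z.2 = phi w.2.
    rewrite -(euclid_norm_polar z.1 (ltW (phi0 z.2))) h1 h2.
    by rewrite euclid_norm_polar // ltW.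
  have n0 : phi w.2 != 0 by rewrite gt_eqF.
  move: h1 h2; rewrite e => /(mulfI n0) hs /(mulfI n0) hc.
  have [n hn] := sin_cos_inj hs hc; exists n.
  by rewrite /deck -hn -[z.2]phiK e phiK; case: w {e n0 hs hc hn}.
- by move=> z; rewrite /polar /reflection /= sinN cosN mulrN.
move=> g cg gE.
pose h z := ((g z).1, (g z).2 - c).
have hE z : exists w, h z = (phi w.2 * sin w.1, phi w.2 * cos w.1).
  have [w gw] := gE z; exists w; rewrite /h -gw /polar /=; congr pair; ring.
have h0 z : h z != (0, 0).
  have [w ->] := hE z; apply/eqP => e.
  have := euclid_norm_polar w.1 (ltW (phi0 w.2)).
  rewrite e /euclid_norm /= expr0n /= addr0 sqrtr0 => e0.
  by have := phi0 w.2; rewrite -e0 ltxx.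
have ch : continuous h by move=> z; rewrite /h; cont.
have [A [cA hA]] := angle_lift_exists ch h0.
exists (fun z => (A z, psi (N (h z)))); split=> z.
- have [w hw] := hE z.
  apply: cont_pair; first by cont.
  apply: (@contF _ _ _ psi); last by apply: cont_enorm; cont.
  by rewrite hw euclid_norm_polar ?ltW.
- have [w hw] := hE z; rewrite /polar /=.
  have -> : phi (psi (N (h z))) = N (h z) by rewrite hw euclid_norm_polar ?ltW // phiK.
  have [h1 h2] := hA z; rewrite -h1 -h2 addrC subrK; by case: (g z).
Qed.

End lift.

(** * Lifts of reversible maps *)

Section reversible.
Variable R : realType.
Implicit Types (z w : R * R) (F G E : R * R -> R * R).
Local Notation refl := (@reflection R).

(** The inverse is carried along so that exchanging [F] and [F'] ([rev_sym]) settles the mirror case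
    of each one-sided argument. *)
Definition rev_sys F F' := [/\ continuous F, continuous F', cancel F F' /\ cancel F' F,
  forall z, F (deck 1 z) = deck 1 (F z) &
  forall z, F (refl z) = refl (F' z)].

Lemma deck_power F (d : int) : (forall z, F (deck 1 z) = deck d (F z)) ->
  forall n z, F (deck n z) = deck (d * n) (F z).
Proof.
move=> h.
have P (n : nat) z : F (deck n z) = deck (d * n) (F z).
  elim: n z => [|n IHn] z; first by rewrite mulr0 !deck0.
  by rewrite -[n.+1]addn1 PoszD -deckD IHn h deckD mulrDr mulr1.
case=> n z; first exact: P.
apply: (@deck_inj _ (d * n.+1)); rewrite -P !deckD NegzE -mulrDr addrN mulr0.
by rewrite !deck0.
Qed.

Lemma rev_deck_comm F F' : rev_sys F F' ->
  forall n z, F (deck n z) = deck n (F z).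
Proof. by move=> [_ _ _ h _] n z; rewrite (deck_power h) mul1r. Qed.

Lemma rev_sym F F' : rev_sys F F' -> rev_sys F' F.
Proof.
move=> [cF cF' [FK F'K] T I]; split=> //.
- by move=> z; apply: (can_inj FK); rewrite F'K T F'K.
- by move=> z; apply: (can_inj FK); rewrite F'K I FK.
Qed.

Lemma continuous_iter F n : continuous F -> continuous (iter n F).
Proof.
move=> cF; elim: n => [|n IHn] z; first exact: contI.
by rewrite /iter -/(iter n F); apply: (@contF _ _ _ F).
Qed.

Lemma iterK F F' n : cancel F F' -> cancel (iter n F) (iter n F').
Proof. by move=> FK z; elim: n => //= n IHn; rewrite -iterS iterSr /= FK. Qed.

Lemma rev_iter F F' n : rev_sys F F' -> rev_sys (iter n F) (iter n F').
Proof.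
move=> [cF cF' [FK F'K] T I]; split.
- exact: continuous_iter.
- exact: continuous_iter.
- by split; exact: iterK.
- by move=> z; elim: n => //= n ->.
- by move=> z; elim: n => //= n ->.
Qed.

Lemma rev_deck F F' j : rev_sys F F' ->
  rev_sys (fun z => deck j (F z)) (fun z => deck (- j) (F' z)).
Proof.
move=> h; have hs := rev_deck_comm h; have hs' := rev_deck_comm (rev_sym h).
have cs := @continuous_deck R j; have cs' := @continuous_deck R (- j).
move: h => [cF cF' [FK F'K] T I]; split.
- by move=> z; cont.
- by move=> z; cont.
- by split=> z; rewrite ?hs ?hs' ?FK ?F'K deckD ?addNr ?addrN deck0.
- by move=> z; rewrite T !deckD addrC.
- by move=> z; rewrite I reflection_deck opprK.
Qed.

Lemma lift_eq E G H : covering E -> continuous G -> continuous H ->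
  (forall z, E (G z) = E (H z)) -> exists n, forall z, H z = deck n (G z).
Proof.
move=> [_ Einj _ _] cG cH e.
have hn z : exists n, H z = deck n (G z) by apply/Einj.
have [] := @continuous_const R (fun z => (H z).1 - (G z).1) 0.
- by move=> z; cont.
- by move=> z; have [n ->] := hn z; exists n; rewrite /=; ring.
move=> n h; exists n => z; have [m hm] := hn z; rewrite hm.
have := h z; rewrite hm /deck /= => e1; congr pair; lra.
Qed.

(* A lift [G] of [f] satisfies [G (deck 1 z) = deck d (G z)] with [d] = 1 or -1, which
   is why [f] is squared.  The lift [F] of the square satisfies [F I = deck l I F']
   for some [l]; then [J = F I] has square [deck l] and anticommutes with [deck],
   and [J J^2 = J^2 J] forces [l = 0]. *)
Lemma lift_rev E f f' : covering E ->
  continuous (f \o E) -> continuous (f' \o E) ->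
  (forall z, exists w, E w = f (E z)) -> (forall z, exists w, E w = f' (E z)) ->
  (forall z, f' (f (E z)) = E z) -> (forall z, f (f' (E z)) = E z) ->
  (forall z, f (refl (E z)) = refl (f' (E z))) ->
  exists F F', [/\ rev_sys F F', forall z, E (F z) = f (f (E z)) &
    forall z, E (F' z) = f' (f' (E z))].
Proof.
move=> cE cf cf' rf rf' fK f'K fI.
have [cntE Einj EI lift] := cE.
have Esh n z : E (deck n z) = E z by apply/esym/Einj; exists n.
have [G [cG hG]] := lift _ cf rf; have [G0 [cG0 hG0]] := lift _ cf' rf'.
have cs1 := @continuous_deck R 1.
have cI := @continuous_reflection R.
have [n hn] : exists n, forall z, G0 (G z) = deck n z.
  apply: (lift_eq cE) => [z|z|z]; [exact: contI| |]; first by cont.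
  by rewrite hG0 /= hG /= fK.
have csn := @continuous_deck R (- n).
pose G' z := deck (- n) (G0 z).
have cG' : continuous G' by move=> z; rewrite /G'; cont.
have hG' z : E (G' z) = f' (E z) by rewrite Esh hG0.
have GK : cancel G G' by move=> z; rewrite /G' hn deckD addNr deck0.
have [m hm] : exists m, forall z, G (G' z) = deck m z.
  apply: (lift_eq cE) => [z|z|z]; [exact: contI| |]; first by cont.
  by rewrite hG /= hG' f'K.
have G'K : cancel G' G.
  (* The composite of [G] after [G'] is [deck m], and it is idempotent because [GK] cancels its
     middle; so [m + m = m]. *)
  suff m0 : m = 0 by move=> z; rewrite hm m0 deck0.
  have := hm (deck m (0, 0)); rewrite -{1}hm GK hm deckD => /deck_eq; lia.
have [d hd] : exists d, forall z, G (deck 1 z) = deck d (G z).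
  apply: (lift_eq cE) => // z; first by cont.
  by rewrite !hG /= Esh.
have [d' hd'] : exists d, forall z, G' (deck 1 z) = deck d (G' z).
  apply: (lift_eq cE) => // z; first by cont.
  by rewrite !hG' /= Esh.
have dd' : d * d' = 1.
  have := G'K (deck 1 (0, 0)); rewrite hd' (deck_power hd) G'K.
  exact: deck_eq.
have dd : d * d = 1 by have := intUnitRing.unitzPl (etrans (mulrC _ _) dd'); rewrite qualifE => /orP[] /eqP ->.
have [k hk] : exists k, forall z, G (refl z) = deck k (refl (G' z)).
  apply: (lift_eq cE) => [z|z|z]; [by cont|by cont|].
  by rewrite EI hG' hG /= EI fI.
pose F z := G (G z); pose F' z := G' (G' z).
have FT z : F (deck 1 z) = deck 1 (F z).
  by rewrite /F hd (deck_power hd) dd.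
have FI z : F (refl z) = deck (d * k + k) (refl (F' z)).
  by rewrite /F hk (deck_power hd) hk deckD.
have F'K : cancel F' F by move=> z; rewrite /F /F' !G'K.
have FK : cancel F F' by move=> z; rewrite /F /F' !GK.
have k0 : d * k + k = 0.
  move: (d * k + k) FI => l FI.
  have J2 z : F (refl (F (refl z))) = deck l z.
    by rewrite (FI (F (refl z))) FK reflectionK.
  have := J2 (F (refl (0, 0))).
  rewrite [F (refl (F (refl (0, 0))))]J2 reflection_deck (deck_power FT) mul1r.
  by move=> /deck_eq; lia.
exists F, F'; split.
- split=> //; try by move=> z; rewrite ?/F ?/F'; cont.
  by move=> z; rewrite FI k0 deck0.
- by move=> z; rewrite hG /= hG.
- by move=> z; rewrite !hG'.
Qed.

End reversible.

(** * Reversible maps of the plane commuting with translations *)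

Section planar.
Variable R : realType.
Implicit Types (z w y a : R * R) (r C : R) (F G K U : R * R -> R * R).
Local Notation refl := (@reflection R).

(** If [K y] were in the half-plane beyond [C], so would be the segment from [K y] to [K a]; its
    preimage under [K] joins the two sides of the line, and where it crosses, a point of the line is
    sent beyond [C]. *)
Lemma sep_lt K K' C : continuous K' -> cancel K K' -> cancel K' K ->
  (forall r, (K (0, r)).1 < C) -> (exists a, 0 <= a.1 /\ C <= (K a).1) ->
  forall y, y.1 <= 0 -> (K y).1 < C.
Proof.
move=> cK' KK K'K hC [a [a0 Ka]] y y0; rewrite ltNge; apply/negP => Ky.
have ch : continuous (fun z => (K' z).1) by move=> z; cont.
have [t t01 ht] := @ivt_seg R _ (K y) (K a) 0 ch ltac:(left; rewrite !KK y0 a0 //).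
have := hC (K' (seg (K y) (K a) t)).2; rewrite -ht -surjective_pairing K'K.
by rewrite ltNge seg_ge.
Qed.

Lemma sep_gt K K' C : continuous K' -> cancel K K' -> cancel K' K ->
  (forall r, C < (K (0, r)).1) -> (exists a, a.1 <= 0 /\ (K a).1 <= C) ->
  forall y, 0 <= y.1 -> C < (K y).1.
Proof.
move=> cK' KK K'K hC [a [a0 Ka]] y y0; rewrite ltNge; apply/negP => Ky.
have ch : continuous (fun z => (K' z).1) by move=> z; cont.
have [t t01 ht] := @ivt_seg R _ (K y) (K a) 0 ch ltac:(right; rewrite !KK y0 a0 //).
have := hC (K' (seg (K y) (K a) t)).2; rewrite -ht -surjective_pairing K'K.
by rewrite ltNge seg_le.
Qed.

Lemma refl_line r : refl (0, r) = (0, r).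
Proof. by rewrite /reflection /= oppr0. Qed.

Lemma rev_line F F' r : rev_sys F F' -> (F' (0, r)).1 = - (F (0, r)).1.
Proof. by move=> /rev_sym[_ _ _ _ I]; rewrite -{1}(refl_line r) I. Qed.

(** On the line, [F'] gives the mirror image of what [F] gives. At first coordinate [pi n] the two
    values differ by [deck n], and one more application of [F] turns this into a return. *)
Lemma rev_line_return F F' r (n : int) : rev_sys F F' ->
  (F (0, r)).1 = pi * n%:~R -> F (F (0, r)) = deck n (0, r).
Proof.
move=> h e; have sh := rev_deck_comm h.
have [_ _ [FK F'K] _ _] := h; have [_ _ _ _ I] := rev_sym h.
have e' : F' (0, r) = deck (- n) (F (0, r)).
  rewrite -{1}(refl_line r) I /reflection /deck intrN e; congr pair; ring.
have E := F'K (0, r); rewrite e' sh in E.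
by rewrite -[in RHS]E deckD addrN deck0.
Qed.

Lemma line_ivt K c r1 r2 : continuous K -> (K (0, r1)).1 <= c <= (K (0, r2)).1 ->
  exists r, (K (0, r)).1 = c.
Proof.
move=> cK h; have cz : continuous (fun z => (K (0, z.2)).1) by move=> z; cont.
have [t _ ht] := @ivt_seg R _ (0, r1) (0, r2) c cz (or_introl h).
by eexists; exact: ht.
Qed.

Definition line_periodic F : set R :=
  [set r | exists k (n : int), (0 < k)%N /\ iter k F (0, r) = deck n (0, r)].

(* A substitute for a fixed point of [F], since a fixed point of the annulus map may
   lie on the boundary, outside the range of the covering. *)
Definition quasi_fixed F := forall k, exists z, `|(iter k F z).1 - z.1| < 2 * pi.

Lemma iter_deck F F' n m x : rev_sys F F' -> F x = deck n x ->
  iter m F x = deck (n * m) x.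
Proof.
move=> h e; elim: m => [|m IHm]; first by rewrite mulr0 deck0.
rewrite iterS IHm (rev_deck_comm h) e deckD; congr deck.
by rewrite -[m.+1]addn1 PoszD mulrDr mulr1.
Qed.

Lemma line_periodic_sym F F' : rev_sys F F' -> line_periodic F `<=` line_periodic F'.
Proof.
move=> h r [k [n [k0 e]]]; exists k, (- n); split=> //.
have [_ _ [FK _] _ _] := rev_iter k h.
have := FK (0, r); rewrite e (rev_deck_comm (rev_iter k (rev_sym h))).
by move=> e'; apply: (@deck_inj _ n); rewrite e' deckD addrN deck0.
Qed.

Lemma quasi_fixed_sym F F' : rev_sys F F' -> quasi_fixed F -> quasi_fixed F'.
Proof.
move=> h q k; have [z hz] := q k; exists (iter k F z).
by have [_ _ [FK _] _ _] := rev_iter k h; rewrite FK distrC.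
Qed.

(** A translate [z] of the near-fixed point has [0 <= z.1 < 2 pi], so its image is below [4 pi], as
    is that of [deck (-1) z] on the other side of the line. The segment between these images meets
    the image of the line. *)
Lemma line_lt F F' : rev_sys F F' -> quasi_fixed F ->
  forall k, exists r, (iter k F (0, r)).1 < 4 * pi.
Proof.
move=> h q k; have [z0 hz0] := q k.
have hk := rev_iter k h; have sh := rev_deck_comm hk.
move: (iter k F) (iter k F') hk sh z0 hz0 => K K' [cK cK' [KK K'K] _ _] sh z0 hz0.
have p0 := pi_gt0 R.
have [n /andP[n1 n2]] := @floor_unit R (2 * pi) z0.1 ltac:(by rewrite mulr_gt0).
pose z := deck (- n) z0.
have z1 : 0 <= z.1 < 2 * pi by rewrite /z /deck /= intrN; apply/andP; split; lra.
have Kz : (K z).1 < 4 * pi.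
  move: hz0; rewrite ltr_norml => /andP[_]; move: z1.
  by rewrite /z sh /deck /= intrN => /andP[_]; lra.
apply: contrapT => no.
have ge r : 4 * pi <= (K (0, r)).1 by rewrite leNgt; apply/negP => ?; apply: no; exists r.
pose a := deck (-1) z.
have a1 : a.1 <= 0 by rewrite /a /deck /=; move: z1 => /andP[_]; lra.
have Ka : (K a).1 < 4 * pi by rewrite /a sh /deck /=; lra.
have ch : continuous (fun z => (K' z).1) by move=> y; cont.
have [t t01 ht] := @ivt_seg R _ (K z) (K a) 0 ch
  ltac:(right; rewrite !KK a1; by case/andP: z1).
have := ge (K' (seg (K z) (K a) t)).2; rewrite -ht -surjective_pairing K'K.
by rewrite leNgt seg_lt.
Qed.

(** The points found have rotation number [5 / (2 (j + 1))] under [K], the iterate of order [2 k]; a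
    point has only one rotation number, so distinct [j] give distinct points. *)
Lemma infinite_line_periodic_ge F F' k r : rev_sys F F' -> quasi_fixed F ->
  4 * pi <= (iter k F (0, r)).1 -> infinite_set (line_periodic F).
Proof.
move=> h q ge.
have p0 := pi_gt0 R.
have k0 : (0 < k)%N by case: k ge => //=; lra.
have [r1 h1] := line_lt h q k.
have [cKk _ _ _ _] := rev_iter k h.
have [r2 h2] := @line_ivt (iter k F) (pi * (4 : int)%:~R) r1 r cKk
  ltac:(apply/andP; split; lra).
have := rev_line_return (rev_iter k h) h2; rewrite -iterD.
have hK := rev_iter (k + k) h.
have EK m x : iter m (iter (k + k) F) x = iter (m * (k + k)) F x by rewrite iterM.
set K := iter (k + k) F in hK EK * => Kr2.
have ex (j : nat) : exists s, iter (j.+1 + j.+1) K (0, s) = deck 5 (0, s).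
  have [s1 hs1] := line_lt h q (j.+1 * (k + k)).
  rewrite -EK in hs1.
  have hr2 := iter_deck j.+1 hK Kr2.
  have [cKj _ _ _ _] := rev_iter j.+1 hK.
  have j1 : 1 <= j.+1%:R :> R by rewrite ler1n.
  (* The image of [s1] is below [4 pi] and that of [r2] is at [8 pi (j + 1)]; 5 is one of the
     integers whose multiple of [pi] lies between for all [j]. *)
  have [s hs] := @line_ivt (iter j.+1 K) (pi * (5 : int)%:~R) s1 r2 cKj
    ltac:(rewrite hr2 /deck /= intrM; apply/andP; split; nra).
  by exists s; rewrite iterD (rev_line_return (rev_iter j.+1 hK) hs).
have [s hs] := choice ex.
have sinj : injective s.
  move=> i j e; have hi := hs i; have hj := hs j; rewrite e in hi.
  have Ei := iter_deck (j.+1 + j.+1) (rev_iter (i.+1 + i.+1) hK) hi.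
  have Ej := iter_deck (i.+1 + i.+1) (rev_iter (j.+1 + j.+1) hK) hj.
  by move: Ei; rewrite -iterM mulnC iterM Ej => /deck_eq; lia.
move=> fin; have := @infinite_nat; apply.
have : finite_set (s @^-1` line_periodic F) by apply: finite_preimage => // x y _ _; exact: sinj.
apply: sub_finite_set => j _ /=.
exists ((j.+1 + j.+1) * (k + k))%N, 5; split; first by lia.
by rewrite -EK.
Qed.

Definition confined F := forall k r, `|(iter k F (0, r)).1| < 4 * pi.

Lemma confined_or_infinite F F' : rev_sys F F' -> quasi_fixed F ->
  confined F \/ infinite_set (line_periodic F).
Proof.
move=> h q; have [c|/existsNP[k /existsNP[r /negP]]] := pselect (confined F).
  by left.
rewrite -leNgt ler_normr => /orP[ge|le]; right.
  exact: infinite_line_periodic_ge h q ge.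
move=> fin; have h' := rev_sym h.
apply: (@infinite_line_periodic_ge F' F k r h' (quasi_fixed_sym h q)).
  by rewrite (rev_line r (rev_iter k h)).
by apply: sub_finite_set fin; exact: line_periodic_sym.
Qed.

Lemma confined_sym F F' : rev_sys F F' -> confined F -> confined F'.
Proof. by move=> h c k r; rewrite (rev_line r (rev_iter k h)) normrN. Qed.

Lemma confined_iter F m : confined F -> confined (iter m F).
Proof. by move=> c k r; rewrite -iterM. Qed.

Lemma confined_lt F F' : rev_sys F F' -> confined F ->
  forall k y, y.1 <= 0 -> (iter k F y).1 < 4 * pi.
Proof.
move=> h c k; have hk := rev_iter k h.
have [_ cK' [KK K'K] _ _] := hk.
apply: (sep_lt cK' KK K'K) => [r|].
  by have := c k r; rewrite ltr_norml => /andP[].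
have p0 := pi_gt0 R.
(* [deck 4] shifts by [8 pi], taking an image that is above [- 4 pi] beyond [4 pi]. *)
exists (deck 4 (0, 0)); split; first by rewrite /=; nra.
rewrite (rev_deck_comm hk) /=; have := c k 0; rewrite ltr_norml => /andP[+ _].
by lra.
Qed.

Lemma confined_gt F F' : rev_sys F F' -> confined F ->
  forall k y, 0 <= y.1 -> - (4 * pi) < (iter k F y).1.
Proof.
move=> h c k; have hk := rev_iter k h.
have [_ cK' [KK K'K] _ _] := hk.
apply: (sep_gt cK' KK K'K) => [r|].
  by have := c k r; rewrite ltr_norml => /andP[].
have p0 := pi_gt0 R.
exists (deck (-4) (0, 0)); split; first by rewrite /=; nra.
rewrite (rev_deck_comm hk) /=; have := c k 0; rewrite ltr_norml => /andP[_].
by lra.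
Qed.

(* The region between the line [x = 0] and its image under the inverse of [G']. *)
Definition crossing G' : set (R * R) := [set z | 0 < z.1 /\ (G' z).1 < 0].

(** The point [a] excludes that [G] exchanges the sides of the line, so [G] maps [0 <= x] into
    [0 < x]. A later iterate of a crossing point then has its preimage under [G] still at [0 < x],
    outside the region. *)
Lemma crossing_wanders G G' : continuous G -> continuous G' ->
  cancel G G' -> cancel G' G ->
  (forall r, 0 < (G (0, r)).1) -> (exists a, a.1 <= 0 /\ (G a).1 <= 0) ->
  [/\ open (crossing G'), crossing G' !=set0,
    forall z k, crossing G' z -> 0 < (iter k G z).1 &
    forall z k, (0 < k)%N -> crossing G' z -> ~ crossing G' (iter k G z)].
Proof.
move=> cG cG' GK G'K G0 Ga.
have mono := sep_gt cG' GK G'K G0 Ga.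
have pos z k : crossing G' z -> 0 < (iter k G z).1.
  by move=> [z0 _]; elim: k => //= k IHk; apply: mono; exact: ltW.
split=> //.
- have c1 : continuous (fun z : R * R => z.1) by move=> z; cont.
  have c2 : continuous (fun z => (G' z).1) by move=> z; cont.
  exact: openI (open_gt_preimage 0 c1) (open_lt_preimage 0 c2).
- have cs : continuous_at 0 (fun s : R => (G (s, 0)).1) by cont.
  have [e /= e0 he] := cont_gt cs (G0 0).
  exists (G (- (e / 2), 0)); split.
    by apply: he; rewrite /= sub0r opprK gtr0_norm; lra.
  by rewrite GK /=; lra.
- move=> z [//|k] _ Uz [_]; rewrite iterS GK ltNge => /negP; apply.
  exact: ltW (pos z k Uz).
Qed.

(* What area preservation in the annulus leaves in its cover, where the area is
   infinite: only bounded orbits recur. *)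
Definition recurrent F := forall n (U : set (R * R)) C, (0 < n)%N -> open U ->
  U !=set0 -> (forall k z, U z -> `|(iter k (iter n F) z).1| <= C) ->
  exists k z, [/\ (0 < k)%N, U z & U (iter k (iter n F) z)].

Lemma recurrent_iter F m : (0 < m)%N -> recurrent F -> recurrent (iter m F).
Proof.
move=> m0 rF n U C n0 oU U0 hU.
have e k z : iter k (iter n (iter m F)) z = iter k (iter (n * m) F) z.
  by rewrite -!iterM mulnA.
have nm : (0 < n * m)%N by rewrite muln_gt0 n0.
have hU' k z : U z -> `|(iter k (iter (n * m) F) z).1| <= C.
  by move=> Uz; rewrite -e; exact: hU.
have [k [z [k0 Uz Ukz]]] := rF _ U C nm oU U0 hU'.
by exists k, z; rewrite e.
Qed.

Lemma recurrent_sym F F' : rev_sys F F' -> recurrent F -> recurrent F'.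
Proof.
move=> h rF n U C n0 oU [u0 Uu0] hU.
have I k z : iter k (iter n F') (refl z) = refl (iter k (iter n F) z).
  by have [_ _ _ _ ->] := rev_iter k (rev_iter n (rev_sym h)).
have oU' : open (refl @^-1` U).
  by apply: open_comp => // z _; exact: continuous_reflection.
have U'0 : refl @^-1` U !=set0 by exists (refl u0); rewrite /= reflectionK.
have hU' k z : (refl @^-1` U) z -> `|(iter k (iter n F) z).1| <= C.
  by move=> Uz; have := hU k (refl z) Uz; rewrite I normrN.
have [k [z [k0 Uz Ukz]]] := rF n _ C n0 oU' U'0 hU'.
by exists k, (refl z); rewrite I.
Qed.

Lemma line_nocross F F' : rev_sys F F' -> confined F -> recurrent F ->
  ~ forall r, 0 < (F (0, r)).1.
Proof.
move=> h c rF pos; have [cF cF' [FK F'K] _ _] := h.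
have p0 := pi_gt0 R.
have Fa : exists a, a.1 <= 0 /\ (F a).1 <= 0.
  exists (deck (-4) (0, 0)); split; first by rewrite /=; nra.
  rewrite (rev_deck_comm h) /=; have := c 1%N 0; rewrite ltr_norml => /andP[_] /=.
  by lra.
have [oU U0 Upos Uw] := crossing_wanders cF cF' FK F'K pos Fa.
have hU k z : crossing F' z -> `|(iter k F z).1| <= 4 * pi.
  move=> Uz; rewrite ler_norml; apply/andP; split.
    by have := Upos z k Uz; lra.
  (* The upper bound is read off one step earlier: [F' z] lies left of the line. *)
  have [_ /ltW F'z] := Uz; have := confined_lt h c k.+1 F'z.
  by rewrite iterSr F'K => /ltW.
have [k [z [k0 Uz Ukz]]] := rF 1%N _ _ isT oU U0 hU.
exact: (Uw z k).
Qed.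

End planar.

(** * The end arc of the symmetry line *)

Section puncture.
Variable R : realType.
Implicit Types (z w y a u : R * R) (r : R) (F G K : R * R -> R * R).
Local Notation refl := (@reflection R).
Local Notation N := (@euclid_norm R).

Lemma polar_exp_covering (c : R) : covering (polar c (@expR R)).
Proof.
apply: (@polar_covering _ _ _ (@ln R)) => [|t|t|t].
- exact: continuous_expR.
- exact: expR_gt0.
- exact: expRK.
- by apply: continuous_ln; exact: expR_gt0.
Qed.

(** The inverse of [polar c expR] from the right half-plane to the strip [0 < x < pi]. Angles start
    at the second axis, so this half-plane is centred at [pi / 2]. *)
Definition half_section (c : R) y : R * R :=
  (angle_near (pi / 2) (y.1, y.2 - c), ln (N (y.1, y.2 - c))).

Lemma half_sectionP (c : R) y : 0 < y.1 ->
  [/\ polar c (@expR R) (half_section c y) = y,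
      0 < (half_section c y).1 < pi & continuous_at y (half_section c)].
Proof.
move=> y1; have d0 : 0 < dirdot (pi / 2) (y.1, y.2 - c).
  by rewrite /dirdot sin_pihalf cos_pihalf /=; lra.
have n0 : 0 < N (y.1, y.2 - c).
  rewrite lt_neqAle euclid_norm_ge0 andbT eq_sym; apply/eqP => /euclid_norm_eq0 [e _].
  by move: y1; rewrite e ltxx.
split.
- have [h1 h2] := has_angle_near d0.
  rewrite /polar /half_section /= lnK ?posrE // -h1 -h2 addrC subrK.
  by case: (y).
- have := angle_near_bound (pi / 2) (y.1, y.2 - c).
  by rewrite /half_section /= => /andP[? ?]; apply/andP; split; lra.
- have cy : continuous_at y (fun y => (y.1, y.2 - c)) by cont.
  rewrite /half_section; apply: cont_pair.
    by apply: cont_angle_near => //; cont.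
  apply: (@contF _ _ _ (@ln R)); first exact: continuous_ln.
  exact: cont_enorm.
Qed.

Lemma polar_exp_range (c : R) y : y != (0, c) -> exists w, polar c (@expR R) w = y.
Proof.
move=> y0; have [a [h1 h2]] := has_angle_ex (y.1, y.2 - c).
have n0 : 0 < N (y.1, y.2 - c).
  rewrite lt_neqAle euclid_norm_ge0 andbT eq_sym; apply: contra y0.
  move=> /eqP/euclid_norm_eq0[e1 e2]; rewrite [y]surjective_pairing e1.
  by apply/eqP; congr pair; lra.
exists (a, ln (N (y.1, y.2 - c))).
rewrite /polar /= lnK ?posrE // -h1 -h2 addrC subrK; by case: (y).
Qed.

Lemma polar_exp_neq (c : R) z : polar c (@expR R) z != (0, c).
Proof.
apply/eqP => -[h1 h2]; have e0 := expR_gt0 z.2.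
have hc : expR z.2 * cos z.1 = 0 by lra.
have := cos2Dsin2 z.1.
move: h1 hc => /eqP; rewrite mulf_eq0 gt_eqF //= => /eqP -> /eqP.
by rewrite mulf_eq0 gt_eqF //= => /eqP -> /eqP; rewrite expr0n /= addr0 eq_sym oner_eq0.
Qed.

Lemma deck_strip n z w : w = deck n z -> 0 < z.1 < pi -> 0 < w.1 < pi -> w = z.
Proof.
move=> -> /andP[z0 z1] /= /andP[w0 w1].
have p0 := pi_gt0 R.
have -> : n = 0 by apply: int_eq0; nra.
exact: deck0.
Qed.

Lemma confined_far F F' (m : int) k y : rev_sys F F' -> confined F ->
  2 * pi * m%:~R <= y.1 -> 2 * pi * m%:~R - 4 * pi < (iter k F y).1.
Proof.
move=> h cF hy; have /(confined_gt h cF k) : 0 <= (deck (- m) y).1.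
  by rewrite /= intrN; lra.
by rewrite (rev_deck_comm (rev_iter k h)) /= intrN; lra.
Qed.

(* [G] is a lift of [K] to the universal cover of the plane minus [(0, c)], in which
   the line [x = 0] covers the arc above [(0, c)]; [farG] says that [G] does not
   rotate near the end [x = +oo] of the plane. *)
Section core.
Variables (G G' K K' : R * R -> R * R) (c : R).
Hypotheses (sG : rev_sys G G') (sK : rev_sys K K').
Hypotheses (cK : confined K) (rK : recurrent K).
Local Notation E := (polar c (@expR R)).
Local Notation sec := (half_section c).
Hypothesis EG : forall z, E (G z) = K (E z).
Hypothesis line0 : forall k r, (0 < k)%N -> (E (iter k G (0, r))).1 != 0.
Hypothesis farG : forall k y, 16 * pi < y.1 -> iter k G (sec y) = sec (iter k K y).
Hypothesis farG' : forall k y, 16 * pi < y.1 -> iter k G' (sec y) = sec (iter k K' y).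
Hypothesis pos : forall r, 0 < (G (0, r)).1.

(** All iterates of the wandering region of [G] stay in the strip [0 < x < pi], where [E] is
    injective with inverse [sec]. Its image [V] in the right half-plane is thus wandering for [K],
    with bounded orbits, against recurrence. *)
Lemma end_arc_core : False.
Proof.
have p0 := pi_gt0 R.
have [cntG cntG' [GK G'K] _ _] := sG.
have far k K0 K0' y : rev_sys K0 K0' -> confined K0 -> 16 * pi < y.1 ->
    0 < (iter k K0 y).1.
  move=> sK0 cK0 hy; have := @confined_far _ _ 2 k y sK0 cK0; move: (iter _ _ _).1 => x.
  by move=> /(_ ltac:(lra)); lra.
(* [20 pi] is beyond the threshold of [farG], so the orbits of [ah] under [G] and [G'] stay in
   [0 < x < pi], and that of [bh] under [G] in [- pi < x < 0]. These points tell the sides of the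
   line apart below. *)
pose ya : R * R := (20 * pi, 0); pose ah := sec ya; pose bh := refl ah.
have ya16 : 16 * pi < ya.1 by rewrite /ya /=; lra.
have hA k : 0 < (iter k G ah).1 < pi.
  by rewrite farG //; have [] := half_sectionP c (far k _ _ _ sK cK ya16).
have hA' k : 0 < (iter k G' ah).1 < pi.
  rewrite farG' //.
  by have [] := half_sectionP c (far k _ _ _ (rev_sym sK) (confined_sym sK cK) ya16).
have hB k : - pi < (iter k G bh).1 < 0.
  have [_ _ _ _ ->] := rev_iter k sG.
  by have /andP[? ?] := hA' k; rewrite /reflection /=; apply/andP; split; lra.
(* By [line0] the image of the line never meets [x = pi]. If it lay beyond, everything right of the
   line would be sent beyond [pi], including [ah]. *)
have lin k r : (0 < k)%N -> (iter k G (0, r)).1 < pi.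
  move=> k0; have [cntk cntk' [kK k'K] _ _] := rev_iter k sG.
  have ch : continuous (fun z : R * R => (iter k G (0, z.2)).1) by move=> z; cont.
  have ne z : (iter k G (0, z.2)).1 != pi.
    by apply: contra (line0 z.2 k0) => /eqP e; rewrite /polar /= e sinpi mulr0.
  have [lt|gt] := continuous_avoid ch ne; first exact: (lt (0, r)).
  have gt' s : pi < (iter k G (0, s)).1 := gt (0, s).
  have /andP[b0 b1] := hB 0%N; have /andP[bk0 bk1] := hB k.
  have /andP[a0 a1] := hA 0%N; have /andP[ak0 ak1] := hA k.
  have := sep_gt cntk' kK k'K gt' (ex_intro _ bh (conj (ltW b1) _)) (ltW a0).
  by move=> /(_ (ltW (lt_trans bk1 p0))); rewrite ltNge ltW.
have Gb : exists a, a.1 <= 0 /\ (G a).1 <= 0.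
  exists bh; have /andP[_ b1] := hB 0%N; have /andP[_ b2] := hB 1%N.
  by split; exact: ltW.
have [oU [u0 Uu0] Upos Uw] := crossing_wanders cntG cntG' GK G'K pos Gb.
have Ustrip u k : crossing G' u -> 0 < (iter k G u).1 < pi.
  move=> Uu; rewrite (Upos u k Uu) /=.
  have [cntk cntk' [kK k'K] _ _] := rev_iter k.+1 sG.
  have hl r : (iter k.+1 G (0, r)).1 < pi by exact: lin.
  have ha : exists a, 0 <= a.1 /\ pi <= (iter k.+1 G a).1.
    (* This translate and its orbit stay between [pi] and [2 pi]. *)
    exists (deck 1 bh); rewrite (rev_deck_comm (rev_iter k.+1 sG)).
    have /andP[b1 _] := hB 0%N; have /andP[b2 _] := hB k.+1.
    by rewrite /deck /=; split; rewrite /= in b1 b2 *; lra.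
  have [_ /ltW u1] := Uu.
  by have := sep_lt cntk' kK k'K hl ha u1; rewrite iterSr G'K.
have secE u : 0 < u.1 < pi -> 0 < (E u).1 /\ sec (E u) = u.
  move=> u1; have Eu : 0 < (E u).1 by rewrite mulr_gt0 ?expR_gt0 ?sin_gt0_pi.
  split=> //; have [e1 s1 _] := half_sectionP c Eu.
  have [_ Einj _ _] := polar_exp_covering c.
  have [n hn] := (Einj _ _).1 (esym e1).
  exact: deck_strip hn u1 s1.
have itE k z : E (iter k G z) = iter k K (E z) by elim: k => //= k IHk; rewrite EG IHk.
pose V := [set y | 0 < y.1 /\ crossing G' (sec y)].
have Vit y k : V y -> [/\ E (iter k G (sec y)) = iter k K y, 0 < (iter k K y).1 &
    sec (iter k K y) = iter k G (sec y)].
  move=> [y0 Uy]; have [e1 _ _] := half_sectionP c y0.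
  have e : E (iter k G (sec y)) = iter k K y by rewrite itE e1.
  by have [] := secE _ (Ustrip _ k Uy); rewrite e.
have oV : open V.
  rewrite openE => y [y0 [s1 s2]]; have [_ _ cs] := half_sectionP c y0.
  have c1 : continuous_at y (fun x => (sec x).1) by apply: (@contF _ _ _ fst) => //; exact: cvg_fst.
  have c2 : continuous_at y (fun x => (G' (sec x)).1).
    by apply: (@contF _ _ _ fst); [exact: cvg_fst|apply: (@contF _ _ _ G')].
  have c0 : continuous_at y (fun x => x.1) by cont.
  have n1 : \forall x \near y, 0 < x.1 by exact: (cont_gt c0 y0).
  have n2 : \forall x \near y, 0 < (sec x).1 by exact: (cont_gt c1 s1).
  have n3 : \forall x \near y, (G' (sec x)).1 < 0 by exact: (cont_lt c2 s2).
  by apply: filterS3 n1 n2 n3 => x x1 x2 x3.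
have V0 : V !=set0.
  by have [] := secE _ (Ustrip _ 0%N Uu0); exists (E u0); split=> //; rewrite b.
have hV k y : V y -> `|(iter k K y).1| <= 20 * pi.
  move=> Vy; have [e1 e2 e3] := Vit y k Vy.
  (* From a point beyond [16 pi], backward iterates of [G'] remain in the strip; but [k + 1] steps
     back from here lead to [G' (sec y)], left of the line. *)
  rewrite gtr0_norm // leNgt; apply/negP => gt.
  have gt' : 16 * pi < (iter k K y).1 by lra.
  have := half_sectionP c (far k.+1 _ _ _ (rev_sym sK) (confined_sym sK cK) gt').
  rewrite -farG' // e3 iterS.
  have [_ _ [kK _] _ _] := rev_iter k sG; rewrite kK => -[_ /andP[+ _] _].
  by have [_ [_ lt]] := Vy; rewrite ltNge ltW.
have [k [y [k0 Vy Vky]]] := @rK 1%N V _ isT oV V0 hV.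
have [_ Uy] := Vy; have [_ +] := Vky.
by have [_ _ ->] := Vit y k Vy; exact: Uw.
Qed.

End core.

Lemma no_free_end_arc F F' (c : R) : rev_sys F F' -> confined F -> recurrent F ->
  F (0, c) = (0, c) ->
  ~ forall k r, (0 < k)%N -> c < r -> (iter k F (0, r)).1 != 0.
Proof.
move=> h cF rF fc free.
have p0 := pi_gt0 R.
have cE := polar_exp_covering c.
pose E := polar c (@expR R); pose sec := half_section c.
have [cntF cntF' [FK F'K] _ FI] := h.
have [cntE Einj EI _] := cE.
have F'c : F' (0, c) = (0, c) by rewrite -{1}fc FK.
have rangeF z : exists w, E w = F (E z).
  apply: polar_exp_range; apply: contra (polar_exp_neq c z) => /eqP e.
  by rewrite -(FK (polar c _ z)) [F _]e F'c.
have rangeF' z : exists w, E w = F' (E z).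
  apply: polar_exp_range; apply: contra (polar_exp_neq c z) => /eqP e.
  by rewrite -(F'K (polar c _ z)) [F' _]e fc.
have [||G0 [G0' [sG0 EG0 EG0']]] := @lift_rev R E F F' cE _ _ rangeF rangeF'
    (fun z => FK _) (fun z => F'K _) (fun z => FI _).
- by move=> z; rewrite /comp; cont.
- by move=> z; rewrite /comp; cont.
pose K := iter 2 F; pose K' := iter 2 F'.
have sK : rev_sys K K' := rev_iter 2 h.
have [cntK _ [KK K'K] _ _] := sK.
have cK : confined K := confined_iter 2 cF.
(* [g] parametrises the half-plane [8 pi < x] by the whole plane, where [lift_eq] applies. Since
   iterates lose less than [4 pi] by [confined_far], [K] keeps this half-plane in [0 < x]; the
   further thresholds [12 pi] and [16 pi] allow for one loss each, for [K'] and for whole orbits. *)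
pose g z : R * R := (8 * pi + expR z.1, z.2).
have cg : continuous g.
  move=> z; rewrite /g; cont; apply: (@contF _ _ _ (@expR R) (fun z => z.1)); last by cont.
  exact: continuous_expR.
have g8 z : 8 * pi < (g z).1 by rewrite /= ltrDl expR_gt0.
have g0 z : 0 < (g z).1 by have := g8 z; move: (g z).1 => x; lra.
have gE y : 8 * pi < y.1 -> exists z, y = g z.
  move=> hy; exists (ln (y.1 - 8 * pi), y.2); rewrite /g /= lnK ?posrE ?subr_gt0 //.
  by rewrite addrC subrK; case: (y).
have K8 y : 8 * pi < y.1 -> 0 < (K y).1.
  move=> hy; have := @confined_far _ _ 4 1 y sK cK; rewrite -/(K y) /=.
  by move: (F _).1 => x /(_ ltac:(lra)); lra.
have [n hn] : exists n, forall z, G0 (sec (g z)) = deck n (sec (K (g z))).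
  have [cG0 _ _ _ _] := sG0.
  apply: (lift_eq cE) => z.
  - have [_ _ cs] := half_sectionP c (K8 _ (g8 z)).
    by apply: (@contF _ _ _ sec) => //; cont.
  - have [_ _ cs] := half_sectionP c (g0 z).
    by apply: (@contF _ _ _ G0); [exact: cG0 | apply: (@contF _ _ _ sec)].
  - have [e1 _ _] := half_sectionP c (K8 _ (g8 z)).
    have [e2 _ _] := half_sectionP c (g0 z).
    by rewrite e1; have := EG0 (sec (g z)); rewrite /E e2 => ->.
(* [G0] exceeds [sec] of [K] by the constant turn [n] on the far half-plane; removing it gives the
   lift that does not rotate there. *)
have sG := rev_deck (- n) sG0.
set G := (X in rev_sys X _) in sG; set G' := (X in rev_sys _ X) in sG.
have Edeck m z : E (deck m z) = E z by apply/esym/Einj; exists m.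
have EG z : E (G z) = K (E z) by rewrite Edeck EG0.
have [cG cG' [GK G'K] _ GI] := sG.
have EG' z : E (G' z) = K' (E z) by rewrite Edeck EG0'.
have A y : 8 * pi < y.1 -> G (sec y) = sec (K y).
  by move=> /gE[z ->]; rewrite /G hn deckD addNr deck0.
have A' y : 12 * pi < y.1 -> G' (sec y) = sec (K' y).
  move=> hy; have K'y : 8 * pi < (K' y).1.
    have := @confined_far _ _ 6 1 y (rev_sym sK) (confined_sym sK cK).
    by rewrite -/(K' y) /=; move: (F' _).1 => x /(_ ltac:(lra)); lra.
  by apply: (can_inj GK); rewrite G'K A // K'K.
have far12 k (K0 K0' : R * R -> R * R) y : rev_sys K0 K0' -> confined K0 ->
    16 * pi < y.1 -> 12 * pi < (iter k K0 y).1.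
  move=> sK0 cK0 hy; have := @confined_far _ _ 8 k y sK0 cK0; move: (iter _ _ _).1 => x.
  by move=> /(_ ltac:(lra)); lra.
have B k y : 16 * pi < y.1 -> iter k G (sec y) = sec (iter k K y).
  move=> hy; elim: k => //= k ->; apply: A.
  by have := far12 k _ _ _ sK cK hy; move: (iter _ _ _).1 => x; lra.
have B' k y : 16 * pi < y.1 -> iter k G' (sec y) = sec (iter k K' y).
  move=> hy; elim: k => //= k ->; apply: A'.
  exact: far12 (rev_sym sK) (confined_sym sK cK) hy.
have line0 k r : (0 < k)%N -> (E (iter k G (0, r))).1 != 0.
  move=> k0; have -> : E (iter k G (0, r)) = iter (k * 2) F (0, c + expR r).
    rewrite iterM; have -> : (0, c + expR r) = E (0, r).
      by rewrite /E /polar /= sin0 cos0 mulr0 mulr1.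
    by elim: k {k0} => //= k IHk; rewrite EG IHk.
  by apply: free; rewrite ?muln_gt0 ?k0 // ltrDl expR_gt0.
have ch : continuous (fun z : R * R => (G (0, z.2)).1) by move=> z; cont.
have ne z : (G (0, z.2)).1 != 0.
  apply/eqP => e; have := line0 1%N z.2 isT.
  have -> : (E (iter 1 G (0, z.2))).1 = expR (G (0, z.2)).2 * sin (G (0, z.2)).1 by [].
  by rewrite e sin0 mulr0 eqxx.
have rK : recurrent K by exact: recurrent_iter.
have [neg|pos] := continuous_avoid ch ne; last first.
  by apply: (end_arc_core sG sK cK rK EG line0 B B') => r; exact: (pos (0, r)).
apply: (end_arc_core (rev_sym sG) (rev_sym sK) (confined_sym sK cK)
  (recurrent_sym sK rK) EG' _ B' B) => [k r k0|r].
- have [_ _ _ _ I] := rev_iter k (rev_sym sG).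
  by rewrite -{1}(refl_line r) I EI oppr_eq0; exact: line0.
- by rewrite (rev_line r sG) oppr_gt0; exact: (neg (0, r)).
Qed.

Lemma common_period F (s : seq R) : exists n, (0 < n)%N /\
  forall r k, r \in s -> (0 < k)%N -> iter k F (0, r) = (0, r) ->
    iter n F (0, r) = (0, r).
Proof.
have iterfix m k r : iter k F (0, r) = (0, r) -> iter (m * k) F (0, r) = (0, r).
  by move=> e; rewrite iterM; elim: m => //= m ->.
elim: s => [|r0 s [n [n0 IHs]]]; first by exists 1%N.
have [[k [k0 e]]|no] := pselect (exists k, (0 < k)%N /\ iter k F (0, r0) = (0, r0)).
  exists (k * n)%N; rewrite muln_gt0 k0; split=> // r j.
  rewrite inE => /orP[/eqP -> _ _|rs j0 ej]; first by rewrite mulnC iterfix.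
  by rewrite iterfix // (IHs r j).
exists n; split=> // r j; rewrite inE => /orP[/eqP -> j0 ej|]; last exact: IHs.
by exfalso; apply: no; exists j.
Qed.

Lemma finite_max (A : set R) : finite_set A -> A !=set0 ->
  exists c, A c /\ forall r, A r -> r <= c.
Proof.
move=> /finite_seqP[s ->]; elim: s => [[]//|r0 s IHs _].
have [[r1 r1s]|no] := pselect ([set` s] !=set0); last first.
  exists r0; split; first by rewrite /= mem_head.
  move=> r /=; rewrite inE => /orP[/eqP -> //|rs].
  by exfalso; apply: no; exists r.
have [c [cs hc]] := IHs (ex_intro _ r1 r1s).
have [le|lt] := leP r0 c; [exists c|exists r0]; split.
- by rewrite /= inE [c \in s]cs orbT.
- by move=> r /=; rewrite inE => /orP[/eqP -> //|]; exact: hc.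
- by rewrite /= mem_head.
- move=> r /=; rewrite inE => /orP[/eqP -> //|rs].
  exact: le_trans (hc r rs) (ltW lt).
Qed.

Theorem planar_infinite F F' : rev_sys F F' -> quasi_fixed F -> recurrent F ->
  infinite_set (line_periodic F).
Proof.
move=> h q rF fin.
have [cF|//] := confined_or_infinite h q.
have [s hs] := (finite_seqP _).1 fin.
have [n [n0 hn]] := common_period F s.
have hH := rev_iter n h; pose H := iter n F.
have [cH _ _ _ _] := hH.
have cfH : confined H := confined_iter n cF.
have rH : recurrent H by exact: recurrent_iter.
(* A mere return to the line is a return with [n = 0] in [rev_line_return], so the point is
   periodic, hence one of the finitely many that [H] fixes. *)
have zero k r : (0 < k)%N -> (iter k H (0, r)).1 = 0 -> H (0, r) = (0, r).
  move=> k0 e.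
  have := @rev_line_return _ _ _ r 0 (rev_iter k hH).
  rewrite mulr0 deck0 => /(_ e); rewrite -iterD -iterM => e2.
  have kn : (0 < (k + k) * n)%N by rewrite muln_gt0 n0 addn_gt0 k0.
  apply: (hn r _ _ kn e2).
  have : line_periodic F r by exists ((k + k) * n)%N, 0; rewrite deck0.
  by rewrite hs.
have [ex|no] := pselect ([set r | H (0, r) = (0, r)] !=set0).
  have finX : finite_set [set r | H (0, r) = (0, r)].
    by apply: sub_finite_set fin => r e; exists n, 0; rewrite deck0.
  have [c [Hc cmax]] := finite_max finX ex.
  apply: (no_free_end_arc hH cfH rH Hc) => k r k0 cr; apply/eqP => e.
  by have := cmax r (zero k r k0 e); rewrite leNgt cr.
have ch : continuous (fun z : R * R => (H (0, z.2)).1) by move=> z; cont.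
have ne z : (H (0, z.2)).1 != 0.
  by apply/eqP => e; apply: no; exists z.2; exact: (zero 1%N).
have [neg|pos] := continuous_avoid ch ne; last first.
  by apply: (line_nocross hH cfH rH) => r; exact: (pos (0, r)).
apply: (line_nocross (rev_sym hH) (confined_sym hH cfH) (recurrent_sym hH rH)) => r.
by rewrite (rev_line r hH) oppr_gt0; exact: (neg (0, r)).
Qed.

End puncture.

(** * Area and recurrence *)

Section area.
Variable R : realType.
Implicit Types (z w y a u : R * R).

Lemma open_borel (O : set (R * R)) : open O -> borel_plane O.
Proof.
move=> oO.
pose box (p : rat * rat * rat) : set (R * R) :=
  `]ratr p.1.1 - ratr p.2, ratr p.1.1 + ratr p.2[%classic `*`
  `]ratr p.1.2 - ratr p.2, ratr p.1.2 + ratr p.2[%classic.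
have -> : O = \bigcup_p (if `[< box p `<=` O >] then box p else set0).
  apply/seteqP; split => [z Oz|z [p _]]; last by case: asboolP => // + bz; apply.
  have /nbhs_ballP[e /= e0 he] := open_nbhs_nbhs (conj oO Oz).
  have [d] := rat_in_itvoo (divr_gt0 e0 (ltr0n R 2)); rewrite in_itv /= => /andP[d0 de].
  have [q1] := rat_in_itvoo (ltac:(lra) : z.1 - ratr d < z.1 + ratr d).
  rewrite in_itv /= => /andP[q11 q12].
  have [q2] := rat_in_itvoo (ltac:(lra) : z.2 - ratr d < z.2 + ratr d).
  rewrite in_itv /= => /andP[q21 q22].
  exists (q1, q2, d) => //; case: asboolP => [_|[]].
    by split; rewrite /= in_itv /=; apply/andP; split; lra.
  move=> y [] /=; rewrite !in_itv /= => /andP[y1 y2] /andP[y3 y4].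
  by apply: he; split; rewrite /ball /= ltr_norml; apply/andP; split; lra.
apply: countable_bigcupT_measurable => // p.
by case: asboolP => // _; exact: measurableX.
Qed.

Local Notation N := (@euclid_norm R).
Local Notation D := (open_annulus R).

Lemma area_le (A B : set (R * R)) : borel_plane A -> borel_plane B -> A `<=` B ->
  (area A <= area B)%E.
Proof.
move=> mA mB AB.
by apply: (@le_measure _ _ _ (@lebesgue_measure R \x @lebesgue_measure R)%E) => //; rewrite inE.
Qed.

Lemma area_box (a b e d : R) : 0 < e -> 0 < d ->
  area (`]a - e, a + e[%classic `*` `]b - d, b + d[%classic) = (4 * e * d)%:E.
Proof.
move=> e0 d0.
have L (x r : R) : 0 < r ->
    lebesgue_measure (`]x - r, x + r[%classic : set R) = (2 * r)%:E.
  move=> r0; rewrite lebesgue_measure_itv /= lte_fin.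
  have -> : x - r < x + r by lra.
  by rewrite -EFinB; congr EFin; ring.
rewrite /area product_measure1E; [|exact: measurable_itv..].
transitivity ((2 * e)%:E * (2 * d)%:E)%E; first by congr (_ * _)%E; exact: L.
by rewrite -EFinM; congr EFin; ring.
Qed.

Lemma open_box (a b e d : R) :
  open (`]a - e, a + e[%classic `*` `]b - d, b + d[%classic : set (R * R)).
Proof.
rewrite openE => y [y1 y2]; exists (`]a - e, a + e[%classic, `]b - d, b + d[%classic) => //.
by split; apply: open_nbhs_nbhs; split=> //; exact: interval_open.
Qed.

Lemma area_open_gt0 (O : set (R * R)) : open O -> O !=set0 -> (0 < area O)%E.
Proof.
move=> oO [z Oz]; have /nbhs_ballP[e /= e0 he] := open_nbhs_nbhs (conj oO Oz).
apply: (@lt_le_trans _ _ (4 * e * e)%:E); first by rewrite lte_fin !mulr_gt0.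
rewrite -(area_box z.1 z.2) //; apply: area_le; try exact: open_borel.
  by apply: open_borel; exact: open_box.
move=> y [] /=; rewrite !in_itv /= => /andP[y1 y2] /andP[y3 y4].
by apply: he; split; rewrite /ball /= ltr_norml; apply/andP; split; lra.
Qed.

(** All the sets lie in one square of finite area, so continuity from above gives their upper limit
    area at least [a]; it is not empty. *)
Lemma area_limsup (A : nat -> set (R * R)) (a : \bar R) (M : R) :
  (forall k, open (A k)) ->
  (forall k z, A k z -> `|z.1| < M /\ `|z.2| < M) ->
  (0 < a)%E -> (forall k, area (A k) = a) ->
  exists x, forall n, exists k, (n <= k)%N /\ A k x.
Proof.
move=> oA AM a0 Aa.
have [M0|M0] := leP M 0.
  have A0 : A 0%N = set0.
    by apply/seteqP; split=> // z /AM[+ _]; rewrite ltNge (le_trans M0).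
  by move: a0; rewrite -(Aa 0%N) A0 /area measure0 ltxx.
have mA k : borel_plane (A k) by exact: open_borel.
pose mu := (@lebesgue_measure R \x @lebesgue_measure R)%E.
have mU n : borel_plane (\bigcup_(k >= n) A k).
  by apply: open_borel; exact: bigcup_open.
have fin : (mu (\bigcup_(k >= 0) A k) < +oo)%E.
  apply: (@le_lt_trans _ _ (area (`]0 - M, 0 + M[%classic `*` `]0 - M, 0 + M[%classic))).
    apply: area_le => //; first by apply: open_borel; exact: open_box.
    move=> z [k _ /AM]; rewrite !ltr_norml => -[/andP[h1 h2] /andP[h3 h4]].
    by split; rewrite /= in_itv /=; apply/andP; split; lra.
  by rewrite area_box // ltry.
have cv := lim_sup_set_cvg mu A mA fin.
have e := cvg_lim (@ereal_hausdorff R) cv.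
have ge : (a <= mu (lim_sup_set A))%E.
  apply: le_trans (_ : a <= lim (mu (\bigcup_(k >= n) A k) @[n --> \oo]))%E _.
    apply: lime_ge; first by apply/cvg_ex; eexists; exact: cv.
    apply: nearW => n; rewrite -(Aa n); apply: area_le => //.
    by move=> z Anz; exists n => /=.
  by rewrite /mu e.
have [x hx] : lim_sup_set A !=set0.
  apply/set0P/eqP => e0; move: ge; rewrite e0 /mu measure0 => /(lt_le_trans a0).
  by rewrite ltxx.
by exists x => n; have [k nk Akx] := hx n I; exists k.
Qed.

End area.

(** * The universal covering of the open annulus *)

Section annulus.
Variable R : realType.
Implicit Types (z w y u : R * R) (a r t : R) (F G : R * R -> R * R).
Local Notation refl := (@reflection R).
Local Notation N := (@euclid_norm R).
Local Notation D := (open_annulus R).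

Definition ann_radius t : R := 3 / 2 + atan t / pi.
Definition ann_height r : R := tan (pi * (r - 3 / 2)).

Lemma radius_bound t : 1 < ann_radius t < 2.
Proof.
have p0 := pi_gt0 R; have := atan_gtNpi2 t; have := atan_ltpi2 t.
rewrite /ann_radius; move: (atan t) => x h1 h2.
have : x / pi < 1 / 2 by rewrite ltr_pdivrMr //; lra.
have : - (1 / 2) < x / pi by rewrite ltr_pdivlMr //; lra.
by move: (x / pi) => v v1 v2; apply/andP; split; lra.
Qed.

Lemma radiusK : cancel ann_radius ann_height.
Proof.
move=> t; rewrite /ann_height /ann_radius.
have -> : pi * (3 / 2 + atan t / pi - 3 / 2) = atan t.
  have : (pi : R) != 0 by rewrite gt_eqF ?pi_gt0.
  by move: (pi : R) (atan t) => p v p0; field.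
exact: atanK.
Qed.

Lemma heightP r : 1 < r < 2 -> ann_radius (ann_height r) = r /\ continuous_at r ann_height.
Proof.
move=> /andP[r1 r2]; have p0 := pi_gt0 R.
have h : - (pi / 2) < pi * (r - 3 / 2) < pi / 2.
  by apply/andP; split; nra.
rewrite /ann_radius /ann_height; split.
  rewrite tanK; last by rewrite in_itv.
  by move: (pi : R) p0 {h} => p p0; field; rewrite gt_eqF.
apply: (@contF _ _ _ (@tan R) (fun r => pi * (r - 3 / 2))); last by cont.
by apply: continuous_tan; rewrite gt_eqF // cos_gt0_pihalf.
Qed.

Definition ann_cover := polar 0 ann_radius.

Lemma euclid_norm_cover z : N (ann_cover z) = ann_radius z.2.
Proof.
rewrite /ann_cover /polar add0r euclid_norm_polar //.
by have /andP[h _] := radius_bound z.2; lra.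
Qed.

Lemma cover_covering : covering ann_cover.
Proof.
apply: (@polar_covering _ _ _ ann_height) => [t|t||t].
- by rewrite /ann_radius; cont.
- by have /andP[h _] := radius_bound t; lra.
- exact: radiusK.
- by have [] := heightP (radius_bound t).
Qed.

Lemma cover_annulus z : D (ann_cover z).
Proof. by rewrite /open_annulus /= euclid_norm_cover; exact: radius_bound. Qed.

Definition ann_section a y := (angle_near a y, ann_height (N y)).

Lemma ann_sectionP a y : 0 < dirdot a y -> D y ->
  ann_cover (ann_section a y) = y /\ continuous_at y (ann_section a).
Proof.
move=> d Dy; have [hr hc] := heightP Dy; split.
  by rewrite /ann_cover /polar /ann_section /= hr add0r; apply: esym; exact: has_angle_near.
rewrite /ann_section; apply: cont_pair.
  by apply: cont_angle_near => //; cont.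
apply: (@contF _ _ _ ann_height) => //; apply: cont_enorm; exact: contI.
Qed.

Lemma cover_surj y : D y -> exists w, ann_cover w = y.
Proof.
move=> Dy; have [a ha] := has_angle_ex y; exists (a, ann_height (N y)).
have [hr _] := heightP Dy.
by rewrite /ann_cover /polar /= hr add0r -ha.
Qed.

Lemma dirdot_cover a t : dirdot a (ann_cover (a, t)) = ann_radius t.
Proof.
rewrite /dirdot /ann_cover /polar /= add0r.
transitivity (ann_radius t * (cos a ^+ 2 + sin a ^+ 2)); first by ring.
by rewrite cos2Dsin2 mulr1.
Qed.

Lemma ann_section_cover u : ann_section u.1 (ann_cover u) = u.
Proof.
rewrite /ann_section euclid_norm_cover radiusK /angle_near.
have -> : (ann_cover u).1 * cos u.1 - (ann_cover u).2 * sin u.1 = 0.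
  by rewrite /ann_cover /polar /= add0r; ring.
by rewrite mul0r atan0 addr0; case: u.
Qed.

Lemma cont_dirdot a y : continuous_at y (dirdot a).
Proof. by rewrite /dirdot; cont. Qed.

Lemma near_annulus y : D y -> \forall x \near y, D x.
Proof.
move=> /andP[y1 y2]; have cN : continuous_at y N by apply: cont_enorm; exact: contI.
by apply: filterS2 (cont_gt cN y1) (cont_lt cN y2) => x x1 x2; apply/andP.
Qed.

(** In the half-plane around the direction [u.1] the covering has the continuous section
    [ann_section u.1]; [V] is the preimage of [U] under it. *)
Lemma cover_open (U : set (R * R)) u : open U -> U u ->
  exists V, [/\ open V, V (ann_cover u), V `<=` D & V `<=` ann_cover @` U].
Proof.
move=> oU Uu; set a := u.1.
exists [set y | [/\ 0 < dirdot a y, D y & U (ann_section a y)]]; split.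
- rewrite openE => y [d Dy Us].
  have [_ cs] := ann_sectionP d Dy.
  have n1 := cont_gt (@cont_dirdot a y) d.
  have n2 := near_annulus Dy.
  have n3 : \forall x \near y, U (ann_section a x).
    by apply: cs; exact: open_nbhs_nbhs.
  by apply: filterS3 n1 n2 n3 => x.
- split; [|exact: cover_annulus|by rewrite ann_section_cover].
  rewrite [u]surjective_pairing dirdot_cover.
  by have /andP[h _] := radius_bound u.2; lra.
- by move=> y [].
- by move=> y [d Dy Us]; exists (ann_section a y) => //; have [] := ann_sectionP d Dy.
Qed.

Lemma infinite_pigeonhole (P : nat -> int -> Prop) (M : nat) :
  (forall n, exists k, (n <= k)%N /\ exists m, P k m /\ `|m| <= M%:Z) ->
  exists k1 k2 m, [/\ (k1 < k2)%N, P k1 m & P k2 m].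
Proof.
move=> inf; apply: contrapT => no.
pose Q k := exists m, P k m /\ `|m| <= M%:Z.
have ex k : exists i : nat, Q k -> (i < M.*2.+1)%N /\ P k (i%:Z - M%:Z).
  have [[m [Pm mM]]|nq] := pselect (Q k); last by exists 0%N.
  exists (absz (m + M%:Z)) => _; split; first by lia.
  by have -> : (absz (m + M%:Z))%:Z - M%:Z = m by lia.
have [f hf] := choice ex.
have fin : finite_set [set k | Q k].
  (* Off [Q] the default falls just outside the range tested next, so the preimage consists of times
     in [Q]. *)
  pose g k := if `[< Q k >] then f k else M.*2.+1.
  apply: (@sub_finite_set _ _ (g @^-1` `I_(M.*2.+1))).
    by move=> k Qk; rewrite /= /g; case: asboolP => // _; have [] := hf k Qk.
  apply: finite_preimage => [k1 k2|]; last exact: finite_II.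
  rewrite !inE /= /g; case: asboolP => // q1; last by rewrite ltnn.
  case: asboolP => // q2; last by rewrite ltnn.
  move=> _ _ e; have [_ h1] := hf _ q1; have [_ h2] := hf _ q2.
  have [lt|lt|//] := ltngtP k1 k2; exfalso; apply: no.
    by exists k1, k2, ((f k1)%:Z - M%:Z); split=> //; rewrite e.
  by exists k2, k1, ((f k1)%:Z - M%:Z); split=> //; rewrite e.
have [s hs] := (finite_seqP _).1 fin.
have [k [sk [m hm]]] := inf (\max_(i <- s) i).+1.
have : [set` s] k by rewrite -hs; exists m.
move=> /= ks; move: sk; rewrite ltnNge => /negP; apply.
exact: (leq_bigmax_seq k ks).
Qed.

(** Openness and containment of the image are included so that the property passes to iterates. *)
Definition open_area_preserving (g : R * R -> R * R) := forall V, open V -> V `<=` D ->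
  [/\ open (g @` V), g @` V `<=` D & area (g @` V) = area V].

Lemma open_area_preserving_iter g k :
  open_area_preserving g -> open_area_preserving (iter k g).
Proof.
move=> gV V oV VD; elim: k => [|k [ok Dk ak]]; first by rewrite image_id.
have -> : iter k.+1 g @` V = g @` (iter k g @` V) by rewrite -image_comp.
by have [og Dg ag] := gV _ ok Dk; split; [exact: og|exact: Dg|rewrite ag].
Qed.

(** Some [x] lies in infinitely many images of [V]. Over it, orbits from [U] reach translates
    [deck m w0] with [m] bounded in terms of [C], so two times [k1 < k2] share the same [m];
    cancelling [k1] steps leaves a return to [U]. *)
Lemma area_recurrent (g : R * R -> R * R) F F' : rev_sys F F' ->
  (forall z, ann_cover (F z) = g (ann_cover z)) ->
  open_area_preserving g -> recurrent F.
Proof.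
move=> h Eg gV n U C n0 oU [u0 Uu0] hU.
have [V [oV Vu0 VD VU]] := cover_open oU Uu0.
have itV k := open_area_preserving_iter k gV oV VD.
have Eit k z : ann_cover (iter k F z) = iter k g (ann_cover z).
  by elim: k => //= k IHk; rewrite Eg IHk.
have bound k z : (iter (k * n) g @` V) z -> `|z.1| < 3 /\ `|z.2| < 3.
  have [_ Dk _] := itV (k * n)%N; move=> /Dk /andP[_ z2].
  have := euclid_norm_sqr z; have n1 := euclid_norm_ge0 z.
  have: N z ^+ 2 < 2 ^+ 2 by rewrite ltr_sqr ?nnegrE //.
  move: (N z) => v v2 e.
  have h1 := sqr_ge0 z.1; have h2 := sqr_ge0 z.2.
  by split; rewrite ltr_norml; apply/andP; split; nra.
have [x hx] : exists x, forall m, exists k, (m <= k)%N /\ (iter (k * n) g @` V) x.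
  apply: (@area_limsup R (fun k => iter (k * n) g @` V) (area V) 3) => //.
  - by move=> k; have [] := itV (k * n)%N.
  - by apply: area_open_gt0 => //; exists (ann_cover u0).
  - by move=> k; have [] := itV (k * n)%N.
have [w0 hw0] : exists w0, ann_cover w0 = x.
  have [k [_ kx]] := hx 0%N; have [_ Dk _] := itV (k * n)%N.
  exact: cover_surj (Dk _ kx).
have [_ Einj _ _] := cover_covering.
pose P (k : nat) (m : int) := exists u, U u /\ iter (k * n) F u = deck m w0.
have inf i : exists k, (i <= k)%N /\
    exists m, P k m /\ `|m| <= (Num.bound (C + `|w0.1|))%:Z.
have [k [ik [v Vv ev]]] := hx i; exists k; split=> //.
have [u Uu Eu] := VU _ Vv.
have [m hm] : exists m, iter (k * n) F u = deck m w0.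
  by apply/Einj; rewrite hw0 -ev Eit Eu.
exists m; split; first by exists u.
have := hU k u Uu; rewrite -iterM hm /= => le.
have p2 := pi_ge2 R.
have C0 : 0 <= C by apply: le_trans le; exact: normr_ge0.
have := archi_boundP (addr_ge0 C0 (normr_ge0 w0.1)).
set B := Num.bound _ => hB.
have : `|m|%:~R < B%:R :> R.
  apply: le_lt_trans hB.
  have l1 : `|2 * pi * m%:~R| <= C + `|w0.1|.
    have -> : 2 * pi * m%:~R = w0.1 + 2 * pi * m%:~R - w0.1 by ring.
    by apply: le_trans (ler_normB _ _) _; rewrite lerD2r.
  apply: le_trans l1; rewrite normrM -intr_norm ger0_norm ?mulr_ge0 //; last by lra.
  have : 0 <= `|m|%:~R :> R by rewrite ler0z.
  by move: (`|m|%:~R : R) => q; nra.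
by rewrite (ltr_int R `|m| B%:Z) => /ltW.
have [k1 [k2 [m [k12 [u1 [Uu1 e1]] [u2 [Uu2 e2]]]]]] := infinite_pigeonhole inf.
have e : iter (k1 * n) F (iter ((k2 - k1) * n) F u2) = iter (k1 * n) F u1.
  by rewrite -iterD -mulnDl subnKC 1?ltnW // e1 e2.
have [_ _ [FK _] _ _] := rev_iter (k1 * n) h.
exists (k2 - k1)%N, u2; rewrite subn_gt0; split=> //.
by rewrite -iterM (can_inj FK e).
Qed.

End annulus.

(** * Invariance of the open annulus *)

Section interior.
Variable R : realType.
Implicit Types (z w y u p : R * R) (a r t : R).
Local Notation N := (@euclid_norm R).
Local Notation A := (closed_annulus R).
Local Notation D := (open_annulus R).

Lemma within_comp (T U V : topologicalType) (B : set U) (f : U -> V) (k : T -> U) (x : T) :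
  {within B, continuous f} -> continuous_at x k -> (forall v, B (k v)) ->
  continuous_at x (fun v => f (k v)).
Proof.
move=> /subspace_continuousP cf ck Bk W fW.
have H : nbhs x [set v | B (k v) -> W (f (k v))] := ck _ (cf _ (Bk x) W fW).
by apply: (filterS _ H) => v; apply.
Qed.

Lemma within_open (U V : topologicalType) (B : set U) (f : U -> V) (x : U) :
  {within B, continuous f} -> nbhs x B -> continuous_at x f.
Proof.
move=> /subspace_continuousP cf nB W fW.
have H : nbhs x [set v | B v -> W (f v)] := cf _ (nbhs_singleton nB) W fW.
have : nbhs x [set v | W (f v)] by apply: filterS2 nB H => v Bv; apply.
by [].
Qed.

(* If [f] sent an interior point [z] to a boundary point [w], the image of a small
   circle around [z] could be contracted in the annulus without meeting [w], along
   segments in polar coordinates around [w]; pulled back by [f'], this would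
   contradict that the circle winds once around [z]. *)
Lemma homeo_interior f f' : {within A, continuous f} -> {within A, continuous f'} ->
  (forall z, A z -> A (f z)) ->
  (forall z, A z -> f' (f z) = z) -> (forall z, A z -> f (f' z) = z) ->
  forall z, D z -> D (f z).
Proof.
move=> cf cf' Af fK f'K z Dz.
have DA y : D y -> A y by move=> /andP[? ?]; apply/andP; split; exact: ltW.
have Az := DA z Dz; have Aw := Af z Az.
set w := f z in Aw *.
apply: contrapT => nDw; have p0 := pi_gt0 R.
have Nw : N w = 1 \/ N w = 2.
  have [e|n1] := eqVneq (N w) 1; first by left.
  have [e|n2] := eqVneq (N w) 2; first by right.
  exfalso; apply: nDw; move: Aw => /andP[h1 h2].
  by apply/andP; rewrite !lt_neqAle h1 h2 n2 eq_sym n1.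
have [al hal] := has_angle_ex w.
(* The depth [t] is counted from the boundary circle through [w]: the factor is 1 on the inner
   circle and -1 on the outer one. In the coordinates [kap], [w] is the origin. *)
pose rho t : R := N w + (3 - 2 * N w) * t.
have rho0 t : 0 <= t <= 1 -> 1 <= rho t <= 2.
  by rewrite /rho => /andP[t0 t1]; case: Nw => ->; apply/andP; split; lra.
pose kap p : R * R := (rho p.2 * sin (al + p.1), rho p.2 * cos (al + p.1)).
have Nkap p : 0 <= p.2 <= 1 -> N (kap p) = rho p.2.
  by move=> /rho0/andP[h _]; rewrite euclid_norm_polar //; lra.
have Akap p : 0 <= p.2 <= 1 -> A (kap p).
  by move=> h; rewrite /closed_annulus /= Nkap // rho0.
have kapw p : 0 <= p.2 <= 1 -> `|p.1| < pi / 2 -> kap p = w -> p = (0, 0).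
  move=> h2 h1 e; have := Nkap _ h2; rewrite e /rho => e2.
  have p2 : p.2 = 0 by case: Nw e2 => ->; lra.
  have w0 : w != (0, 0).
    apply/eqP => w0; case: Nw; rewrite w0 /euclid_norm /= expr0n /= addr0 sqrtr0; lra.
  have hal2 : has_angle w (al + p.1).
    by rewrite /has_angle -{1}e /kap p2 /rho mulr0 addr0.
  have [n hn] := has_angle_inj w0 hal hal2.
  have p1 : p.1 = 2 * pi * n%:~R by lra.
  move: h1; rewrite p1 ltr_norml => /andP[h3 h4].
  have n0 : n = 0 by apply: int_eq0; nra.
  by rewrite [p]surjective_pairing p1 p2 n0 mulr0.
have nDz := near_annulus Dz.
have cfz : continuous_at z f.
  by apply: (within_open cf); apply: filterS nDz => y; exact: DA.
have d0 : 0 < dirdot al w.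
  have <- : N w = dirdot al w.
    rewrite {2}hal /dirdot /=.
    transitivity (N w * (cos al ^+ 2 + sin al ^+ 2)); last by ring.
    by rewrite cos2Dsin2 mulr1.
  by case: Nw => ->.
have cdf : continuous_at z (fun y => dirdot al (f y)).
  by apply: (@contF _ _ _ (dirdot al)) => //; exact: cont_dirdot.
have /nbhs_ballP[e /= e0 he] : nbhs z [set y | D y /\ 0 < dirdot al (f y)].
  by apply: filterS2 nDz (cont_gt cdf d0) => y.
pose eta := e / 2.
have eta0 : 0 < eta by rewrite divr_gt0.
pose c s : R * R := (z.1 + eta * sin s, z.2 + eta * cos s).
have cP s : D (c s) /\ 0 < dirdot al (f (c s)).
  apply: he; have hs := sin_max s; have hc := cos_max s.
  have he2 : eta < e by rewrite /eta; lra.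
  split; rewrite /ball /= opprD addrA addrN sub0r normrN normrM (gtr0_norm eta0).
    by apply: le_lt_trans he2; rewrite ler_piMr // ltW.
  by apply: le_lt_trans he2; rewrite ler_piMr // ltW.
have Ac s : A (c s) by apply: DA; have [] := cP s.
have cc : continuous c by move=> s; rewrite /c; cont.
pose k1 p := f (c p.1).
have ck1 : continuous k1.
  have cc1 : continuous (fun p : R * R => c p.1) by move=> p; cont.
  by move=> p; exact: (within_comp cf (cc1 p) (fun p => Ac p.1)).
pose aa p := angle_near al (k1 p) - al.
pose tt p := (N (k1 p) - N w) / (3 - 2 * N w).
have caa : continuous aa.
  move=> p; rewrite /aa; cont.
  by apply: cont_angle_near; [have [] := cP p.1|cont|cont].
have ctt : continuous tt by move=> p; rewrite /tt; cont; apply: cont_enorm; cont.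
have aab p : `|aa p| < pi / 2.
  have /andP[h1 h2] := angle_near_bound al (k1 p).
  by rewrite /aa ltr_norml; apply/andP; split; lra.
have rtt p : rho (tt p) = N (k1 p).
  by rewrite /rho /tt; case: Nw => ->; field.
have ttb p : 0 <= tt p <= 1.
  have /andP[h1 h2] : 1 <= N (k1 p) <= 2 := Af _ (Ac p.1).
  rewrite /tt; move: (N (k1 p)) h1 h2 => x h1 h2; case: Nw => ->.
    have -> : 3 - 2 * 1 = 1 :> R by ring.
    by rewrite divr1; apply/andP; split; lra.
  have -> : 3 - 2 * 2 = -1 :> R by ring.
  by rewrite invrN1 mulrN1; apply/andP; split; lra.
have kk p : kap (aa p, tt p) = k1 p.
  have [_ d] := cP p.1; have := has_angle_near d; rewrite -/(k1 p) => E.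
  by rewrite /kap /= rtt /aa addrC subrK -E.
(* Truncation to [[0, 1]], which extends the homotopy to the whole plane as [angle_lift_exists]
   requires. *)
pose lam (v : R) := 1 / 2 + clamp (1 / 2) (v - 1 / 2).
have lam01 v : 0 <= lam v <= 1.
  have := @clamp_le R (1/2) (v - 1/2) ltac:(lra); rewrite ler_norml => /andP[h1 h2].
  by rewrite /lam; apply/andP; split; lra.
have lam1 : lam 1 = 1 by rewrite /lam clamp_id; [lra|rewrite ger0_norm; lra].
have lam0 : lam 0 = 0 by rewrite /lam clamp_id; [lra|rewrite ler0_norm; lra].
have clam : continuous lam by move=> v; rewrite /lam /clamp; cont.
(* The curve is contracted to the point at depth [1 / 2] behind [w]. The depth is at least
   [(1 - lam) / 2], so depth 0, and with it [w], could occur only at [lam = 1], on the image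
   circle. *)
pose hm p := (lam p.2 * aa p, lam p.2 * tt p + (1 - lam p.2) / 2).
have hmb p : 0 <= (hm p).2 <= 1.
  have /andP[l0 l1] := lam01 p.2; have /andP[t0 t1] := ttb p.
  by rewrite /hm /=; apply/andP; split; nra.
have chm : continuous (fun p => kap (hm p)).
  by move=> p; rewrite /kap /rho /hm /=; cont.
pose Gam p : R * R := ((f' (kap (hm p))).1 - z.1, (f' (kap (hm p))).2 - z.2).
have cGam : continuous Gam.
  have cfh : continuous (fun p => f' (kap (hm p))).
    by move=> p; apply: (within_comp cf' (chm p)) => y; exact: Akap.
  by move=> p; rewrite /Gam; cont.
have Gam0 p : Gam p != (0, 0).
  apply/eqP => -[/subr0_eq e1 /subr0_eq e2].
  have ez : f' (kap (hm p)) = z by rewrite [LHS]surjective_pairing e1 e2; case: (z).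
  have ew : kap (hm p) = w by rewrite -(f'K _ (Akap _ (hmb p))) ez.
  have /andP[l0 l1] := lam01 p.2; have /andP[t0 t1] := ttb p.
  have hm1 : `|(hm p).1| < pi / 2.
    rewrite /hm /= normrM (ger0_norm l0); apply: le_lt_trans (aab p).
    by rewrite ler_piMl.
  have [h1 h2] := kapw _ (hmb p) hm1 ew.
  have lam1' : lam p.2 = 1 by nra.
  move: h1 h2; rewrite lam1' !mul1r subrr mul0r addr0 => h1 h2.
  have kw : k1 p = w by rewrite -kk h1 h2 -ew /hm h1 h2 lam1' subrr !mulr0 mul0r addr0.
  have cz : c p.1 = z by rewrite -(fK _ (Ac p.1)) -/(k1 p) kw fK.
  have [c1 c2] : eta * sin p.1 = 0 /\ eta * cos p.1 = 0.
    by move: cz; rewrite /c; case: (z) => z1 z2 /= -[]; lra.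
  have := cos2Dsin2 p.1; move: c1 c2 => /eqP; rewrite mulf_eq0 gt_eqF //= => /eqP -> /eqP.
  by rewrite mulf_eq0 gt_eqF //= => /eqP ->; rewrite expr0n /=; lra.
have [th [cth hth]] := angle_lift_exists cGam Gam0.
have per s v : Gam (s + 2 * pi, v) = Gam (s, v).
  have cper : c (s + 2 * pi) = c s.
    by rewrite /c; have [h1 h2] := sin_cos_2pin s 1; rewrite mulr1 in h1 h2; rewrite h1 h2.
  by rewrite /Gam /hm /aa /tt /k1 /= cper.
(* The winding number [n] is the same at all stages [p.2]; it is 0 at stage 0, where [Gam] is
   constant, and 1 at stage 1, where [Gam] runs round the circle. *)
have [n hn] : exists n : int, forall p, th (p.1 + 2 * pi, p.2) - th p = 0 + 2 * pi * n%:~R.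
  apply: continuous_const; first by move=> p; cont.
  move=> p; have h1 := hth (p.1 + 2 * pi, p.2); rewrite per -surjective_pairing in h1.
  by have [n ->] := has_angle_inj (Gam0 p) (hth p) h1; exists n; ring.
have [m0 hm0] : exists m : int, forall p, th (p.1, 0) = th (0, 0) + 2 * pi * m%:~R.
  apply: continuous_const; first by move=> p; cont.
  move=> p; apply: (has_angle_inj (Gam0 (0, 0)) (hth _)).
  have -> : Gam (0, 0) = Gam (p.1, 0).
    by rewrite /Gam /hm /= lam0 !mul0r.
  exact: hth.
have [m1 hm1] : exists m : int, forall p, th (p.1, 1) - p.1 = 0 + 2 * pi * m%:~R.
  apply: continuous_const; first by move=> p; cont.
  move=> p; have G1 : Gam (p.1, 1) = (eta * sin p.1, eta * cos p.1).
    rewrite /Gam /hm /= lam1 !mul1r subrr mul0r addr0.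
    rewrite -[aa _]/(aa (p.1, 1)) kk /k1 fK // /c /=; congr pair; ring.
  have h1 : has_angle (Gam (p.1, 1)) p.1.
    by rewrite /has_angle G1 euclid_norm_polar // ltW.
  by have [m ->] := has_angle_inj (Gam0 _) h1 (hth (p.1, 1)); exists m; ring.
have := hn (0, 0); have := hn (0, 1); rewrite /=.
have := hm0 (0 + 2 * pi, 0); have := hm0 (0, 0); rewrite /=.
have := hm1 (0 + 2 * pi, 0); have := hm1 (0, 0); rewrite /=.
move: (th _) (th (0, 1)) (th (0, 0)) => *; lra.
Qed.

End interior.

(** * Reduction of the annulus to the plane *)

Section final.
Variable R : realType.
Implicit Types (z w y u p : R * R) (a r t : R) (f g F G : R * R -> R * R).
Local Notation N := (@euclid_norm R).
Local Notation D := (open_annulus R).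
Local Notation refl := (@reflection R).

Lemma strip_deck al u w (n : int) : w = deck n u -> `|u.1 - al| < pi / 2 ->
  `|w.1 - al| < pi / 2 -> w = u.
Proof.
move=> -> h1 h2; have p0 := pi_gt0 R.
move: h1 h2; rewrite /= !ltr_norml => /andP[h1 h2] /andP[h3 h4].
have -> : n = 0 by apply: int_eq0; nra.
exact: deck0.
Qed.

Lemma ann_section_strip al u : `|u.1 - al| < pi / 2 ->
  0 < dirdot al (ann_cover u) /\ ann_section al (ann_cover u) = u.
Proof.
move=> hu; have d : 0 < dirdot al (ann_cover u).
  have -> : dirdot al (ann_cover u) = ann_radius u.2 * cos (u.1 - al).
    by rewrite /dirdot /ann_cover /polar /= cosB; ring.
  have /andP[r1 _] := radius_bound u.2.
  by rewrite mulr_gt0 ?cos_gt0_pihalf -?ltr_norml //; lra.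
split=> //; have [e _] := ann_sectionP d (cover_annulus u).
have [_ Einj _ _] := cover_covering R.
have [n hn] := (Einj _ _).1 (esym e).
apply: strip_deck hn hu _.
have /andP[h1 h2] := angle_near_bound al (ann_cover u).
by rewrite /ann_section /= ltr_norml; apply/andP; split; lra.
Qed.

Lemma radius_mono : {homo @ann_radius R : s t / s <= t}.
Proof.
by move=> s t st; rewrite /ann_radius lerD2l ler_pM2r ?invr_gt0 ?pi_gt0 // le_atan.
Qed.

(* Near the fixed point [z0], which may be on the boundary, the lift of [g] that moves
   one point by less than half a turn moves all points by less than half a turn. *)
Lemma quasi_fixed_lift (B : set (R * R)) g F F' z0 : rev_sys F F' ->
  (forall z, ann_cover (F z) = g (ann_cover z)) -> D `<=` B ->
  (B `<=` closed_annulus R) ->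
  {within B, continuous g} -> (forall z, D z -> D (g z)) ->
  B z0 -> g z0 = z0 -> exists j, quasi_fixed (fun z => deck j (F z)).
Proof.
move=> h EF DB BA cg Dg Bz0 gz0; have p0 := pi_gt0 R.
have [cF _ _ _ _] := h.
have /andP[r1 r2] := BA _ Bz0.
have [al hal] := has_angle_ex z0.
have d0 : 0 < dirdot al z0.
  have <- : N z0 = dirdot al z0.
    rewrite {2}hal /dirdot /=.
    transitivity (N z0 * (cos al ^+ 2 + sin al ^+ 2)); last by ring.
    by rewrite cos2Dsin2 mulr1.
  by lra.
have nearg (Q : set (R * R)) : nbhs z0 Q -> \forall y \near z0, B y -> Q (g y).
  move=> nQ; move: cg => /subspace_continuousP/(_ _ Bz0) cgz.
  by apply: (cgz Q); rewrite /from_subspace gz0.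
pose pol p : R * R := (p.2 * sin p.1, p.2 * cos p.1).
have cpol : continuous pol by move=> p; rewrite /pol; cont.
have pol0 : pol (al, N z0) = z0 by rewrite /pol /= -hal.
have polnear (Q : set (R * R)) : nbhs z0 Q -> exists2 e, 0 < e &
    forall a r, `|a - al| < e -> `|r - N z0| < e -> Q (pol (a, r)).
  move=> nQ; have : nbhs (al, N z0) (pol @^-1` Q) by apply: cpol; rewrite pol0.
  move=> /nbhs_ballP[e /= e0 he]; exists e => // a r ha hr.
  by apply: he; split; rewrite /ball /= distrC.
have coverE u : ann_cover u = pol (u.1, ann_radius u.2) by rewrite /ann_cover /polar /pol add0r.
have nd : nbhs z0 [set y | 0 < dirdot al y].
  by apply: (cont_gt (@cont_dirdot R al z0) d0).
have [e e0 he] := polnear _ (nearg _ nd).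
pose box u := `|u.1 - al| < Num.min e (pi / 2) /\ `|ann_radius u.2 - N z0| < e.
have boxd u : box u -> 0 < dirdot al (ann_cover (F u)).
  move=> [+ u2]; rewrite lt_min => /andP[u1 _]; rewrite EF.
  by rewrite coverE; apply: (he u.1 (ann_radius u.2)) => //; rewrite -coverE; exact: DB (cover_annulus u).
have win u : 0 < dirdot al (ann_cover u) -> exists n : int, `|u.1 + 2 * pi * n%:~R - al| < pi / 2.
  move=> d; have [e1 _] := ann_sectionP d (cover_annulus u).
  have [_ Einj _ _] := cover_covering R; have [n hn] := (Einj _ _).1 (esym e1).
  exists n; have := congr1 fst hn; rewrite /= => <-.
  have /andP[h1 h2] := angle_near_bound al (ann_cover u).
  by rewrite ltr_norml; apply/andP; split; lra.
have boxseg u u' t : 0 <= t <= 1 -> box u -> box u' -> box (seg u u' t).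
  move=> t01 [u1 u2] [u'1 u'2]; split.
    have -> : (seg u u' t).1 - al = (seg (u.1 - al, 0) (u'.1 - al, 0) t).1.
      by rewrite /=; ring.
    move: u1 u'1; rewrite !ltr_norml => /andP[? ?] /andP[? ?].
    by rewrite seg_gt ?seg_lt.
  move: u2 u'2; rewrite !ltr_norml => /andP[h1 h2] /andP[h3 h4].
  case/andP: t01 => t0 t1.
  have [le|/ltW le] := leP u.2 u'.2.
    have l1 : ann_radius u.2 <= ann_radius (seg u u' t).2 by apply: radius_mono; rewrite /=; nra.
    have l2 : ann_radius (seg u u' t).2 <= ann_radius u'.2 by apply: radius_mono; rewrite /=; nra.
    by apply/andP; split; lra.
  have l1 : ann_radius u'.2 <= ann_radius (seg u u' t).2 by apply: radius_mono; rewrite /=; nra.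
  have l2 : ann_radius (seg u u' t).2 <= ann_radius u.2 by apply: radius_mono; rewrite /=; nra.
  by apply/andP; split; lra.
(* As [z0] may be on the boundary, radii of the open annulus are obtained by moving from [N z0]
   towards [3 / 2]. *)
have dense e1 : 0 < e1 -> exists r, 1 < r < 2 /\ `|r - N z0| < e1.
  move=> e10; pose d := Num.min e1 1 / 2.
  have d01 : 0 < d <= 1 / 2.
    rewrite /d divr_gt0 ?lt_min ?e10 //= ler_pM2r ?invr_gt0 // ge_min lexx orbT //.
  have de : d < e1.
    rewrite /d; have : Num.min e1 1 <= e1 by rewrite ge_min lexx.
    by have /andP[] := d01; rewrite /d; lra.
  case/andP: d01 => d00 d1; move: d d00 d1 de => d d00 d1 de.
  exists (N z0 + (3 / 2 - N z0) * d); split; first by apply/andP; split; nra.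
  rewrite addrC addKr normrM (gtr0_norm d00).
  have : `|3 / 2 - N z0| <= 1 / 2 by rewrite ler_norml; apply/andP; split; lra.
  by move: `|_| => v hv; nra.
have pt e1 : 0 < e1 -> exists u, u.1 = al /\ `|ann_radius u.2 - N z0| < e1.
  move=> /dense[r [r12 hr]]; exists (al, ann_height r); split=> //=.
  by have [-> _] := heightP r12.
have e'0 : 0 < Num.min e (pi / 2) by rewrite lt_min e0 divr_gt0.
have [u0 [u01 u02]] := pt e e0.
have bu0 : box u0 by split=> //; rewrite u01 subrr normr0.
have [n0 hn0] := win _ (boxd _ bu0).
have ch : continuous (fun u => (F u).1) by move=> u; cont.
have const u : box u -> `|(F u).1 + 2 * pi * n0%:~R - al| < pi / 2.
  move=> bu; have [n hn] := win _ (boxd _ bu).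
  suff -> : n0 = n by [].
  (* Images of the box point within a quarter turn of [al], so the lift never takes the opposite
     direction; by continuity it would have to if [n0] and [n] differed. *)
  have avoid (k : int) t : 0 <= t <= 1 -> (F (seg u0 u t)).1 != al + pi + 2 * pi * k%:~R.
    move=> t01; apply/eqP => e1.
    have [m] := win _ (boxd _ (boxseg _ _ _ t01 bu0 bu)).
    by rewrite e1; exact: odd_turn_far.
  move: hn hn0; rewrite !ltr_norml => /andP[h1 h2] /andP[h3 h4].
  have [lt|gt|//] := ltgtP n0 n; exfalso.
  - have le : n0%:~R + 1 <= n%:~R :> R by rewrite -(intrD _ n0 1) ler_int lezD1.
    have le' := ler_wpM2l (ltW p0) le.
    have [|t t01 ht] := @ivt_seg R (fun u => (F u).1) u0 u (al + pi + 2 * pi * (- n0 - 1)%:~R) ch.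
      by right; rewrite intrB intrN; apply/andP; split; lra.
    by have := avoid (- n0 - 1) t t01; rewrite ht eqxx.
  - have le : n%:~R + 1 <= n0%:~R :> R by rewrite -(intrD _ n 1) ler_int lezD1.
    have le' := ler_wpM2l (ltW p0) le.
    have [|t t01 ht] := @ivt_seg R (fun u => (F u).1) u0 u (al + pi + 2 * pi * (- n0)%:~R) ch.
      by left; rewrite intrN; apply/andP; split; lra.
    by have := avoid (- n0) t t01; rewrite ht eqxx.
exists n0; set F1 := fun z => deck n0 (F z).
have EF1 u : ann_cover (F1 u) = g (ann_cover u).
  rewrite -EF; have [_ Einj _ _] := cover_covering R.
  by apply/esym/Einj; exists n0.
(* The neighbourhood depends on [k]: that of the previous step is pulled back by [g], which is
   continuous at [z0] within [B] and fixes it. *)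
have S k : \forall y \near z0, D y -> forall u, ann_cover u = y -> `|u.1 - al| < pi / 2 ->
    `|(iter k F1 u).1 - al| < pi / 2.
  elim: k => [|k IHk]; first by apply: (@filterE _ (nbhs z0) (nbhs_filter z0)) => y Dy u _.
  have ca : continuous_at z0 (fun y => `|angle_near al y - al|).
    by cont; apply: cont_angle_near => //; cont.
  have cN : continuous_at z0 (fun y => `|N y - N z0|).
    by cont; apply: cont_enorm; cont.
  have a0 : `|angle_near al z0 - al| < Num.min e (pi / 2).
    have h1 : z0.1 = N z0 * sin al := congr1 fst hal.
    have h2 : z0.2 = N z0 * cos al := congr1 snd hal.
    have -> : angle_near al z0 = al.
      rewrite /angle_near; have -> : z0.1 * cos al - z0.2 * sin al = 0.
        by rewrite h1 h2; ring.
      by rewrite mul0r atan0 addr0.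
    by rewrite subrr normr0.
  have N0 : `|N z0 - N z0| < e by rewrite subrr normr0.
  have n1 := cont_lt ca a0; have n2 := cont_lt cN N0.
  have n3 := nearg _ IHk.
  apply: filterS3 n1 n2 n3 => y y1 y2 y3 Dy u Eu hu.
  have [_ su] := ann_section_strip hu.
  have bu : box u.
    split; last by rewrite -euclid_norm_cover Eu.
    by rewrite -su /ann_section /= Eu.
  rewrite iterSr; apply: (y3 (DB _ Dy) (Dg _ Dy)); first by rewrite EF1 Eu.
  exact: const bu.
move=> k; have [e1 e10 he1] := polnear _ (S k).
have [u [ua ur]] := pt e1 e10; exists u.
have hu : `|u.1 - al| < pi / 2 by rewrite ua subrr normr0 divr_gt0.
have := he1 u.1 (ann_radius u.2) ltac:(by rewrite ua subrr normr0) ur.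
rewrite -coverE => /(_ (cover_annulus u) u erefl hu); rewrite ua.
by lra.
Qed.

End final.

Lemma within_iter (U : topologicalType) (B : set U) (g : U -> U) n :
  {within B, continuous g} -> (forall x, B x -> B (g x)) ->
  {within B, continuous (iter n g)}.
Proof.
move=> /subspace_continuousP cg gB; apply/subspace_continuousP => x Bx.
have itB m : B (iter m g x) by elim: m => //= m; exact: gB.
elim: n => [|n IHn]; first exact: cvg_within.
move=> W nW; have H := IHn _ (cg _ (itB n) W nW).
have H' : nbhs x [set v | B v -> B (iter n g v) -> W (g (iter n g v))] := H.
apply: filterS H' => v h Bv; apply: h => //.
by elim: n {IHn itB nW H} => //= n; exact: gB.
Qed.

Lemma open_image_of_inverse (R : realType) (B V : set (R * R)) (f f' : R * R -> R * R) :
  {within B, continuous f'} -> open_annulus R `<=` B ->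
  (forall z, open_annulus R z -> open_annulus R (f z)) ->
  (forall z, B z -> f' (f z) = z) -> (forall z, B z -> f (f' z) = z) ->
  open V -> V `<=` open_annulus R -> open (f @` V).
Proof.
move=> cf' DB Df fK f'K oV VD.
have -> : f @` V = [set y | open_annulus R y /\ V (f' y)].
  apply/seteqP; split => [_ [z Vz <-]|y [Dy Vy]].
    by split; [apply: Df; exact: VD | rewrite fK //; apply: DB; exact: VD].
  by exists (f' y) => //; rewrite f'K //; exact: DB.
rewrite openE => y [Dy Vy].
have nD := near_annulus Dy.
have cy : continuous_at y f' by apply: (within_open cf'); apply: filterS nD => x; exact: DB.
have nV : \forall x \near y, V (f' x) by apply: cy; exact: open_nbhs_nbhs.
by apply: filterS2 nD nV => x.
Qed.

Theorem theorem1p1 (R : realType) (Omega : set (R * R)) (f : R * R -> R * R)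
    (hOmega : Omega = closed_annulus R \/ Omega = open_annulus R)
    (hrev : reversible_map Omega f)
    (harea : area_preserving Omega f) :
  (forall z, ~ periodic_point Omega f z) \/
  infinite_set
    [set z | symmetric_periodic_point Omega f z /\ open_annulus R z].
Proof.
have [[z0 [Oz0 [k0 [k00 ek0]]]]|no] := pselect (exists z, periodic_point Omega f z);
  last by left=> z pz; apply: no; exists z.
right; have [_ [[Of inj surj] cf cf'] rev] := hrev.
set f' := pinv Omega f in cf' rev.
have DA : open_annulus R `<=` closed_annulus R.
  by move=> z /andP[? ?]; apply/andP; split; exact: ltW.
have DO : open_annulus R `<=` Omega by case: hOmega => -> //.
have OA : Omega `<=` closed_annulus R by case: hOmega => -> //.
have fK z : Omega z -> f' (f z) = z by move=> Oz; rewrite /f' pinvKV // inE.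
have f'K z : Omega z -> f (f' z) = z by move=> /surj[x Ox <-]; rewrite fK.
have Of' z : Omega z -> Omega (f' z).
  by move=> /surj[x Ox <-]; rewrite fK.
have Df z : open_annulus R z -> open_annulus R (f z).
  case: hOmega => e; last by rewrite -e; exact: Of.
  by rewrite e in cf cf' Of fK f'K; exact: homeo_interior cf cf' Of fK f'K z.
have Df' z : open_annulus R z -> open_annulus R (f' z).
  case: hOmega => e; last by rewrite -e; exact: Of'.
  by rewrite e in cf cf' Of' fK f'K; exact: homeo_interior cf' cf Of' f'K fK z.
have Oc z : Omega (ann_cover z) by apply: DO; exact: cover_annulus.
have [cntE _ EI _] := cover_covering R.
have cfE : continuous (f \o @ann_cover R).
  by move=> z; exact: within_comp cf (cntE z) Oc.
have cfE' : continuous (f' \o @ann_cover R).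
  by move=> z; exact: within_comp cf' (cntE z) Oc.
have [F1 [F1' [sF1 EF1 _]]] := lift_rev (cover_covering R) cfE cfE'
  (fun z => cover_surj (Df _ (cover_annulus z)))
  (fun z => cover_surj (Df' _ (cover_annulus z)))
  (fun z => fK _ (Oc z)) (fun z => f'K _ (Oc z)) (fun z => rev _ (Oc z)).
(* [lift_rev] lifts the square of [f], whence the factor 2. *)
pose g := iter (k0 * 2) f.
have gE k z : iter k g z = iter (k * (k0 * 2)) f z by rewrite iterM.
have sF2 := rev_iter k0 sF1.
have EF2 z : ann_cover (iter k0 F1 z) = g (ann_cover z).
  by rewrite /g iterM; elim: k0 {ek0 k00 g gE sF2} => //= k IHk; rewrite EF1 IHk.
have gz0 : g z0 = z0 by rewrite /g mulnC iterM /= !ek0.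
have Dg z : open_annulus R z -> open_annulus R (g z).
  by rewrite /g; elim: (k0 * 2)%N => //= k IHk Dz; apply: Df; exact: IHk.
have [j qF] := quasi_fixed_lift sF2 EF2 DO OA (within_iter cf Of) Dg Oz0 gz0.
have sF := rev_deck j sF2.
set F := (X in rev_sys X _) in sF.
have Edeck (z : R * R) : ann_cover (deck j z) = ann_cover z.
  by have [_ Einj _ _] := cover_covering R; apply/esym/Einj; exists j.
have EF (z : R * R) : ann_cover (F z) = g (ann_cover z) by rewrite Edeck EF2.
have af : open_area_preserving f.
  move=> V oV VD; split.
  - exact: open_image_of_inverse cf' DO Df fK f'K oV VD.
  - by move=> _ [z Vz <-]; apply: Df; exact: VD.
  - by apply: harea; [exact: open_borel | move=> z /VD/DO].
have rF : recurrent F.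
  exact: area_recurrent sF EF (open_area_preserving_iter _ af).
apply: contra_not (planar_infinite sF qF rF) => fin.
have : finite_set ((fun r => ann_cover (0, r)) @^-1`
    [set z | symmetric_periodic_point Omega f z /\ open_annulus R z]).
  apply: finite_preimage fin => r s _ _ e.
  have [_ Einj _ _] := cover_covering R; have [n] := (Einj _ _).1 e.
  by move=> /(congr1 snd).
apply: sub_finite_set => r [k [n [k1 e]]]; split; last exact: cover_annulus.
have per : iter (k * (k0 * 2)) f (ann_cover (0, r)) = ann_cover (0, r).
  rewrite -gE; have <- : ann_cover (iter k F (0, r)) = iter k g (ann_cover (0, r)).
    by elim: k {k1 e} => //= k IHk; rewrite EF IHk.
  by rewrite e; have [_ Einj _ _] := cover_covering R; exact: esym ((Einj (0, r) (deck n (0, r))).2 (ex_intro _ n erefl)).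
split; first exact: Oc.
(* The point is on the axis of the reflection, so a period also serves as the exponent [l]. *)
exists (k * (k0 * 2))%N, (k * (k0 * 2))%N; split=> //.
- by rewrite !muln_gt0 k1 k00.
- by rewrite !muln_gt0 k1 k00.
- by rewrite -EI refl_line.
Qed.
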